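(* Assume the setting and the algorithm FDGM-AA described in the context, with $\beta\in(0,1/L)$, and assume B-connectivity: there is an integer $B\ge1$ such that for every $k\ge0$ the graph $(\mathcal V,\bigcup_{t=k}^{k+B-1}\mathcal E^t)$ is connected. Then for all $k\ge0$, $$ D(\mathbf w^k)-D^\star\le\frac{\tau R_0^2\,(D(\mathbf w^0)-D^\star)}{\tau R_0^2+\underline\lambda\lfloor k/B\rfloor\,(D(\mathbf w^0)-D^\star)}, $$ $$ \|\mathbf x^k-\mathbf x^\star\|\le\sqrt{2L\,(D(\mathbf w^k)-D^\star)},\qquad |F(\mathbf x^k)-F^\star|\le(R_0+\|\mathbf w^0\|)\sqrt{2L\,(D(\mathbf w^k)-D^\star)}, $$ where $\tau=\frac{3BL^2\tilde\eta}{\theta_2}+\frac{3}{\underline h\,\theta_1}$, $\theta_1=\min\{\beta(1-\beta L),c_1\}$, $\theta_2=\min\{(1/\beta-L)/2,c_2\}$.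
   Context: Setting. Let $n,d\ge 1$ be integers and $\mathcal V=\{1,\dots,n\}$. For each $i\in\mathcal V$, $f_i:\mathbb R^d\to\mathbb R\cup\{+\infty\}$ is proper, lower semicontinuous and $\mu$-strongly convex for some $\mu>0$ (i.e. $f_i-\frac{\mu}{2}\|\cdot\|^2$ is convex), and the interior of $\bigcap_{i\in\mathcal V}\mathrm{dom} f_i$ is nonempty. Let $d_i(w)=\sup_{x\in\mathbb R^d}\{\langle w,x\rangle-f_i(x)\}$ be the convex conjugate of $f_i$; it is differentiable with $L$-Lipschitz gradient where $L=1/\mu$, and $\nabla d_i(w)=\arg\max_x\{\langle w,x\rangle-f_i(x)\}$. For $\mathbf w=(w_1,\dots,w_n)\in(\mathbb R^d)^n$ put $D(\mathbf w)=\sum_{i\in\mathcal V}d_i(w_i)$. Networks. $\mathcal G^k=(\mathcal V,\mathcal E^k)$, $k\ge0$, is a sequence of undirected graphs; $\mathcal N_i^k=\{j:\{i,j\}\in\mathcal E^k\}$. For each $\{i,j\}\in\mathcal E^k$ a weight $h_{ij}^k=h_{ji}^k>0$ is given, with $\underline h:=\inf_{k\ge0}\min_{\{i,j\}\in\mathcal E^k}h_{ij}^k>0$ and $\sum_{j\in\mathcal N_i^k}h_{ij}^k\le 1$ for all $i,k$. Algorithm FDGM-AA. Parameters: step-size $\beta>0$, constants $c_1,c_2>0$, integer memory $m\ge1$. Initial point $w_1^0,\dots,w_n^0\in\mathbb R^d$ with $\sum_i w_i^0=0$. At iteration $k\ge0$, for each edge $\{i,j\}\in\mathcal E^k$: let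 $\mathcal I_{ij}^k=\mathcal I_{ji}^k$ be the set of the $\min\{m,N\}$ largest indices $t\le k$ with $\{i,j\}\in\mathcal E^t$, where $N$ is the number of such $t$ (so $k\in\mathcal I_{ij}^k$). Let $W_{ij}^k$ and $D_{ij}^k$ be the $d\times|\mathcal I_{ij}^k|$ matrices with columns $w_i^t$ and $\nabla d_i(w_i^t)$, $t\in\mathcal I_{ij}^k$, and define $W_{ji}^k$, $D_{ji}^k$ analogously with $w_j^t$, $\nabla d_j(w_j^t)$. Let $(\alpha_{ij}^k,\alpha_{ji}^k)$ be any minimizer of $\|D_{ij}^k\alpha_{ij}-D_{ji}^k\alpha_{ji}\|^2$ subject to $W_{ij}^k\alpha_{ij}+W_{ji}^k\alpha_{ji}=w_i^k+w_j^k$, $\mathbf 1^T\alpha_{ij}=1$, $\mathbf 1^T\alpha_{ji}=1$. Set $\tilde w_{ij}=W_{ij}^k\alpha_{ij}^k$, $\tilde w_{ji}=W_{ji}^k\alpha_{ji}^k$, $\bar w_{ij}=\tilde w_{ij}-\beta(D_{ij}^k\alpha_{ij}^k-D_{ji}^k\alpha_{ji}^k)$, $\bar w_{ji}=\tilde w_{ji}-\beta(D_{ji}^k\alpha_{ji}^k-D_{ij}^k\alpha_{ij}^k)$. Let $g=\nabla d_i(w_i^k)-\nabla d_j(w_j^k)$ and $\rho=\min\{-c_1\|g\|^2,\,-c_2(\|\bar w_{ij}-w_i^k\|^2+\|\bar w_{ji}-w_j^k\|^2)\}$. Safe-guard test (one of the following two, fixed for the whole run): (S1) $d_i(\bar w_{ij})+d_j(\bar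 w_{ji})-d_i(w_i^k)-d_j(w_j^k)\le\rho$; or (S2) $\langle\nabla d_i(w_i^k),\bar w_{ij}-w_i^k\rangle+\frac L2\|\bar w_{ij}-w_i^k\|^2+\langle\nabla d_j(w_j^k),\bar w_{ji}-w_j^k\rangle+\frac L2\|\bar w_{ji}-w_j^k\|^2\le\rho$. If the test holds, set $(w_{ij}^{k+\frac12},w_{ji}^{k+\frac12})=(\bar w_{ij},\bar w_{ji})$; otherwise set $w_{ij}^{k+\frac12}=w_i^k-\beta g$, $w_{ji}^{k+\frac12}=w_j^k+\beta g$. Finally, for every $i\in\mathcal V$, $w_i^{k+1}=(1-\sum_{j\in\mathcal N_i^k}h_{ij}^k)w_i^k+\sum_{j\in\mathcal N_i^k}h_{ij}^k w_{ij}^{k+\frac12}$. Write $\mathbf w^k=(w_1^k,\dots,w_n^k)$ and $x_i^k=\nabla d_i(w_i^k)$. Further notation. $\mathbf x^k=(x_1^k,\dots,x_n^k)$ and $F(\mathbf x)=\sum_i f_i(x_i)$. $F^\star$ is the optimal value and $\mathbf x^\star=(x^\star,\dots,x^\star)$ the (unique) optimal solution of minimizing $F(\mathbf x)$ subject to $x_1=\dots=x_n$; $D^\star$ is the optimal value of minimizing $D(\mathbf w)$ subject to $\sum_i w_i=0$. For $k\ge0$ let $\tilde{\mathcal E}^k=\bigcup_{t=k}^{k+B-1}\mathcal E^t$, $\tilde{\mathcal G}^k=(\mathcal V,\tilde{\mathcal E}^k)$, $\mathcal L_{\tilde{\mathcal G}^k}$ its (unweighted) graph Laplacian, $\eta^k$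 its maximum degree, $\tilde\eta=\sup_{t\ge0}\eta^{tB}$, and $\underline\lambda=\inf_{t\ge0}\lambda_{\min}(\mathcal L_{\tilde{\mathcal G}^{tB}})$, where $\lambda_{\min}$ denotes the smallest nonzero eigenvalue. $S_0=\{\mathbf w:D(\mathbf w)\le D(\mathbf w^0),\ \sum_i w_i=0\}$ (a compact set) and $R_0=\max\{\|\mathbf w-\mathbf u\|:\mathbf w,\mathbf u\in S_0\}$. *)

(* Defs.v *)
From HB Require Import structures.
From mathcomp Require Import all_boot all_order all_algebra.
From mathcomp Require Import all_classical all_reals all_analysis.
Set Implicit Arguments. Unset Strict Implicit. Unset Printing Implicit Defensive.
Import Order.TTheory GRing.Theory Num.Theory.
Import numFieldNormedType.Exports.
Local Open Scope classical_set_scope.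
Local Open Scope ring_scope.

Definition dotv {R : realType} {d : nat} (x y : 'rV[R]_d) : R :=
  \sum_(i < d) x 0 i * y 0 i.
Definition normv {R : realType} {d : nat} (x : 'rV[R]_d) : R :=
  Num.sqrt (dotv x x).
Definition normS {R : realType} {n d : nat} (W : 'I_n -> 'rV[R]_d) : R :=
  Num.sqrt (\sum_(i < n) dotv (W i) (W i)).

Definition dom {R : realType} {d : nat} (f : 'rV[R]_d -> \bar R) : set 'rV[R]_d :=
  [set x | (f x < +oo)%E].
Definition proper_fun {R : realType} {d : nat} (f : 'rV[R]_d -> \bar R) : Prop :=
  (forall x, f x != -oo%E) /\ (exists x, (f x < +oo)%E).
Definition strongly_convex {R : realType} {d : nat} (mu : R)
  (f : 'rV[R]_d -> \bar R) : Prop :=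
  let g := fun x : 'rV[R]_d => (f x - (mu / 2 * normv x ^+ 2)%:E)%E in
  forall (x y : 'rV[R]_d) (t : R), 0 < t < 1 ->
    (g (t *: x + (1 - t) *: y)%R <= t%:E * g x + (1 - t)%:E * g y)%E.
(* convex conjugate  d(w) = sup_x <w,x> - f(x)  (finite in our setting) *)
Definition conjf {R : realType} {d : nat} (f : 'rV[R]_d -> \bar R) (w : 'rV[R]_d) : R :=
  fine (ereal_sup [set ((dotv w x)%:E - f x)%E | x in [set: 'rV[R]_d]]).
Definition Dval {R : realType} {n d : nat} (f : 'I_n -> 'rV[R]_d -> \bar R)
  (w : 'I_n -> 'rV[R]_d) : R := \sum_(i < n) conjf (f i) (w i).
Definition Fval {R : realType} {n d : nat} (f : 'I_n -> 'rV[R]_d -> \bar R)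
  (x : 'I_n -> 'rV[R]_d) : \bar R := (\sum_(i < n) f i (x i))%E.
Definition Dstar {R : realType} {n d : nat} (f : 'I_n -> 'rV[R]_d -> \bar R) : R :=
  inf [set Dval f w | w in [set w : 'I_n -> 'rV[R]_d | \sum_(i < n) w i = 0]].
Definition Fstar {R : realType} {n d : nat} (f : 'I_n -> 'rV[R]_d -> \bar R) : \bar R :=
  ereal_inf [set Fval f (fun _ => x) | x in [set: 'rV[R]_d]].
Definition S0 {R : realType} {n d : nat} (f : 'I_n -> 'rV[R]_d -> \bar R)
  (w0 : 'I_n -> 'rV[R]_d) : set ('I_n -> 'rV[R]_d) :=
  [set w | Dval f w <= Dval f w0 /\ \sum_(i < n) w i = 0].
Definition R0 {R : realType} {n d : nat} (f : 'I_n -> 'rV[R]_d -> \bar R)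
  (w0 : 'I_n -> 'rV[R]_d) : R :=
  sup [set r | exists w u, S0 f w0 w /\ S0 f w0 u /\ r = normS (fun i => w i - u i)].

Definition union_edges {n : nat} (E : nat -> rel 'I_n) (B k : nat) : rel 'I_n :=
  fun i j => [exists t : 'I_B, E (k + t)%N i j].
Definition graph_connected {n : nat} (e : rel 'I_n) : Prop :=
  forall i j, connect e i j.
Definition udeg {n : nat} (e : rel 'I_n) (i : 'I_n) : nat := #|[set j | e i j]|.
Definition maxdeg {n : nat} (e : rel 'I_n) : nat := (\max_(i < n) udeg e i)%N.
Definition laplacian {R : realType} {n : nat} (e : rel 'I_n) : 'M[R]_n :=
  \matrix_(i, j) (if i == j then (udeg e i)%:R else - (e i j)%:R).
Definition lambda_min_nz {R : realType} {n : nat} (M : 'M[R]_n) : R :=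
  inf [set a : R | a != 0 /\ eigenvalue M a].
Definition lambda_low {R : realType} {n : nat} (E : nat -> rel 'I_n) (B : nat) : R :=
  inf [set lambda_min_nz (@laplacian R n (union_edges E B (t * B))) | t in [set: nat]].
Definition eta_tilde {R : realType} {n : nat} (E : nat -> rel 'I_n) (B : nat) : R :=
  sup [set ((maxdeg (union_edges E B (t * B)))%:R : R) | t in [set: nat]].
Definition h_low {R : realType} {n : nat} (E : nat -> rel 'I_n) (h : nat -> 'I_n -> 'I_n -> R) : R :=
  inf [set r | exists k i j, E k i j /\ r = h k i j].

Definition Iset {n : nat} (E : nat -> rel 'I_n) (m : nat) (i j : 'I_n) (k : nat) : seq nat :=
  take m (rev (seq.filter (fun t => E t i j) (iota 0 k.+1))).
(* W_ij^k a  and  D_ij^k a  (columns indexed by t in I) *)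
Definition Wcomb {R : realType} {n d : nat} (w : nat -> 'I_n -> 'rV[R]_d)
  (i : 'I_n) (I : seq nat) (a : nat -> R) : 'rV[R]_d :=
  \sum_(t <- I) a t *: w t i.
Definition Dcomb {R : realType} {n d : nat} (g : 'I_n -> 'rV[R]_d -> 'rV[R]_d)
  (w : nat -> 'I_n -> 'rV[R]_d) (i : 'I_n) (I : seq nat) (a : nat -> R) : 'rV[R]_d :=
  \sum_(t <- I) a t *: g i (w t i).
Definition AA_feasible {R : realType} {n d : nat} (w : nat -> 'I_n -> 'rV[R]_d)
  (I : seq nat) (k : nat) (i j : 'I_n) (a b : nat -> R) : Prop :=
  Wcomb w i I a + Wcomb w j I b = w k i + w k j /\
  \sum_(t <- I) a t = 1 /\ \sum_(t <- I) b t = 1.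
Definition AA_obj {R : realType} {n d : nat} (g : 'I_n -> 'rV[R]_d -> 'rV[R]_d)
  (w : nat -> 'I_n -> 'rV[R]_d) (I : seq nat) (i j : 'I_n) (a b : nat -> R) : R :=
  normv (Dcomb g w i I a - Dcomb g w j I b) ^+ 2.
Definition AA_minimizer {R : realType} {n d : nat} (E : nat -> rel 'I_n) (m : nat)
  (g : 'I_n -> 'rV[R]_d -> 'rV[R]_d) (w : nat -> 'I_n -> 'rV[R]_d)
  (k : nat) (i j : 'I_n) (a b : nat -> R) : Prop :=
  let I := Iset E m i j k in
  AA_feasible w I k i j a b /\
  forall a' b', AA_feasible w I k i j a' b' ->
    AA_obj g w I i j a b <= AA_obj g w I i j a' b'.
Definition wbar {R : realType} {n d : nat} (E : nat -> rel 'I_n) (m : nat)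
  (g : 'I_n -> 'rV[R]_d -> 'rV[R]_d) (beta : R) (w : nat -> 'I_n -> 'rV[R]_d)
  (k : nat) (i j : 'I_n) (a b : nat -> R) : 'rV[R]_d :=
  let I := Iset E m i j k in
  Wcomb w i I a - beta *: (Dcomb g w i I a - Dcomb g w j I b).
(* w_ij^{k+1/2}, given alpha_ij^k = a and alpha_ji^k = b; s1 = true selects (S1), false (S2) *)
Definition half_step {R : realType} {n d : nat} (s1 : bool)
  (f : 'I_n -> 'rV[R]_d -> \bar R) (g : 'I_n -> 'rV[R]_d -> 'rV[R]_d)
  (E : nat -> rel 'I_n) (m : nat) (L beta c1 c2 : R) (w : nat -> 'I_n -> 'rV[R]_d)
  (k : nat) (i j : 'I_n) (a b : nat -> R) : 'rV[R]_d :=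
  let wij := wbar E m g beta w k i j a b in
  let wji := wbar E m g beta w k j i b a in
  let gg := g i (w k i) - g j (w k j) in
  let rho := Num.min (- (c1 * normv gg ^+ 2))
                     (- (c2 * (normv (wij - w k i) ^+ 2 + normv (wji - w k j) ^+ 2))) in
  let test :=
    if s1 then
      conjf (f i) wij + conjf (f j) wji - conjf (f i) (w k i) - conjf (f j) (w k j) <= rho
    else
      dotv (g i (w k i)) (wij - w k i) + L / 2 * normv (wij - w k i) ^+ 2 +
      dotv (g j (w k j)) (wji - w k j) + L / 2 * normv (wji - w k j) ^+ 2 <= rho in
  if test then wij else w k i - beta *: gg.
Definition FDGM_AA_run {R : realType} {n d : nat} (s1 : bool)
  (f : 'I_n -> 'rV[R]_d -> \bar R) (g : 'I_n -> 'rV[R]_d -> 'rV[R]_d)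
  (E : nat -> rel 'I_n) (h : nat -> 'I_n -> 'I_n -> R) (m : nat) (L beta c1 c2 : R)
  (w : nat -> 'I_n -> 'rV[R]_d) (alpha : nat -> 'I_n -> 'I_n -> nat -> R) : Prop :=
  \sum_(i < n) w 0%N i = 0 /\
  (forall k i j, E k i j -> AA_minimizer E m g w k i j (alpha k i j) (alpha k j i)) /\
  (forall k i, w k.+1 i =
     (1 - \sum_(j < n | E k i j) h k i j) *: w k i +
     \sum_(j < n | E k i j) h k i j *:
        half_step s1 f g E m L beta c1 c2 w k i j (alpha k i j) (alpha k j i)).

(* Main.v *)
Require Import Defs.
From HB Require Import structures.
From mathcomp Require Import all_boot all_order all_algebra.
From mathcomp Require Import all_classical all_reals all_analysis.
From mathcomp Require Import ring lra.
Set Implicit Arguments.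
Unset Strict Implicit.
Unset Printing Implicit Defensive.
Import Order.TTheory GRing.Theory Num.Theory.
Import numFieldNormedType.Exports.
Local Open Scope classical_set_scope.
Local Open Scope ring_scope.

(* Whether the safeguard accepts or rejects, the two half-steps on an edge keep
   [w_i + w_j] and decrease [d_i + d_j] by at least [theta1 |x_i - x_j|^2] and
   at least [theta2] times the squared displacement.  Averaging is a convex
   combination, so every iteration decreases [D] by a multiple of both the
   disagreement of the [x_i] along active edges and the squared move of [w].
   An edge active somewhere in a block of [B] iterations has, at the start of
   the block, a disagreement controlled by the disagreement at its active time
   plus the drift of its end points; summing over the union graph bounds its
   Laplacian energy by [tau] times the decrease of [D] over the block.  The
   spectral gap and convexity of [D] turn the energy into
   [lambda (D - Dstar)^2 / R0^2], which gives the [1 / t] rate.  The bounds on the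
   primal iterates follow from strong duality: a dual minimiser exists by
   compactness of the sublevel set, its gradients all equal [xstar], and strong
   convexity in the Fenchel inequality controls [x - xstar]. *)

(** * Euclidean geometry *)

Section EuclideanSpace.
Variables (R : realType) (d : nat).
Implicit Types (x y z : 'rV[R]_d) (a t : R).

Lemma dotvC x y : dotv x y = dotv y x.
Proof. by apply: eq_bigr => i _; rewrite mulrC. Qed.

Lemma dotvDl x y z : dotv (x + y) z = dotv x z + dotv y z.
Proof. by rewrite -big_split; apply: eq_bigr => i _; rewrite mxE mulrDl. Qed.

Lemma dotvZl a x z : dotv (a *: x) z = a * dotv x z.
Proof. by rewrite mulr_sumr; apply: eq_bigr => i _; rewrite mxE mulrA. Qed.

Lemma dotvNl x z : dotv (- x) z = - dotv x z.
Proof. by rewrite -scaleN1r dotvZl mulN1r. Qed.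

Lemma dotvBl x y z : dotv (x - y) z = dotv x z - dotv y z.
Proof. by rewrite dotvDl dotvNl. Qed.

Lemma dotvDr x y z : dotv z (x + y) = dotv z x + dotv z y.
Proof. by rewrite !(dotvC z) dotvDl. Qed.

Lemma dotvZr a x z : dotv z (a *: x) = a * dotv z x.
Proof. by rewrite !(dotvC z) dotvZl. Qed.

Lemma dotvNr x z : dotv z (- x) = - dotv z x.
Proof. by rewrite !(dotvC z) dotvNl. Qed.

Lemma dotvBr x y z : dotv z (x - y) = dotv z x - dotv z y.
Proof. by rewrite !(dotvC z) dotvBl. Qed.

Lemma dot0v z : dotv 0 z = 0.
Proof. by rewrite -(scale0r z) dotvZl mul0r. Qed.

Lemma dotv_suml (I : Type) (r : seq I) (P : pred I) (F : I -> 'rV[R]_d) z :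
  dotv (\sum_(i <- r | P i) F i) z = \sum_(i <- r | P i) dotv (F i) z.
Proof.
by apply: (big_morph (fun x => dotv x z)) => [x y|]; rewrite ?dotvDl ?dot0v.
Qed.

Definition dotvE := (dotvDl, dotvZl, dotvNl, dotvDr, dotvZr, dotvNr).

Lemma dotv_distC x y : dotv (x - y) (x - y) = dotv (y - x) (y - x).
Proof. by rewrite -opprB dotvNl dotvNr opprK. Qed.

Lemma dotv_ge0 x : 0 <= dotv x x.
Proof. by apply: sumr_ge0 => i _; rewrite -expr2 sqr_ge0. Qed.

Lemma dotv_eq0 x : dotv x x = 0 -> x = 0.
Proof.
move=> /psumr_eq0P x0; apply/rowP => i; rewrite mxE.
have /eqP := x0 (fun j _ => sqr_ge0 (x 0 j)) i isT.
by rewrite mulf_eq0 orbb => /eqP.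
Qed.

Lemma normv_sqr x : normv x ^+ 2 = dotv x x.
Proof. by rewrite sqr_sqrtr ?dotv_ge0. Qed.

(* Uses [|v|^2 >= 2 <v, q> - |q|^2] with [q] the combination itself. *)
Lemma dotv_sum_le (I : finType) (P : pred I) (c : I -> R) (v : I -> 'rV[R]_d) :
  (forall i, P i -> 0 <= c i) -> \sum_(i | P i) c i <= 1 ->
  dotv (\sum_(i | P i) c i *: v i) (\sum_(i | P i) c i *: v i) <=
  \sum_(i | P i) c i * dotv (v i) (v i).
Proof.
move=> c0 c1; set q := \sum_(i | P i) c i *: v i.
have -> : dotv q q = 2 * dotv q q - dotv q q by ring.
apply: (@le_trans _ _ (\sum_(i | P i) c i * (2 * dotv (v i) q - dotv q q))).
  rewrite (eq_bigr (fun i => 2 * dotv (c i *: v i) q - c i * dotv q q)).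
    rewrite sumrB -mulr_sumr -dotv_suml -mulr_suml -/q lerD2l lerN2.
    by rewrite ler_piMl ?dotv_ge0.
  by move=> i _; rewrite dotvZl; ring.
apply: ler_sum => i Pi; apply: ler_wpM2l; first exact: c0.
have := dotv_ge0 (v i - q); rewrite !dotvE (dotvC q (v i)); lra.
Qed.

End EuclideanSpace.

(** A quadratic that is nonnegative on the whole line has nonpositive discriminant. It yields both
    Cauchy-Schwarz inequalities, and with [a = 0] the vanishing of a first-order term. *)
Lemma sqr_le_of_quadratic (R : realType) (a b c : R) :
  (forall t, 0 <= a - 2 * t * b + t ^+ 2 * c) -> 0 <= c -> b ^+ 2 <= a * c.
Proof.
move=> + c0; move: c0; rewrite le_eqVlt => /predU1P[<-|c0] q0.
  have [->|b0] := eqVneq b 0; first by rewrite mulr0 expr0n.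
  (* The quadratic is affine here and takes the value -1 at this point. *)
  have := q0 ((a + 1) / (2 * b)).
  suff -> : a - 2 * ((a + 1) / (2 * b)) * b + ((a + 1) / (2 * b)) ^+ 2 * 0 = -1
    by rewrite ler0N1.
  by field.
have := q0 (b / c).
have -> : a - 2 * (b / c) * b + (b / c) ^+ 2 * c = (a * c - b ^+ 2) / c.
  by field; rewrite gt_eqF.
by rewrite pmulr_lge0 ?invr_gt0// subr_ge0.
Qed.

(** * Inner product and norm on families of vectors *)

Section ProductSpace.
Variables (R : realType) (n d : nat).
Implicit Types W U : 'I_n -> 'rV[R]_d.

Definition dotS W U : R := \sum_(i < n) dotv (W i) (U i).

Lemma dotS_ge0 W : 0 <= dotS W W.
Proof. by apply: sumr_ge0 => i _; exact: dotv_ge0. Qed.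

Lemma normSE W : normS W = Num.sqrt (dotS W W).
Proof. by []. Qed.

Lemma normS_ge0 W : 0 <= normS W.
Proof. exact: sqrtr_ge0. Qed.

Lemma normS_sqr W : normS W ^+ 2 = dotS W W.
Proof. by rewrite sqr_sqrtr ?dotS_ge0. Qed.

Lemma dotS_expand W U t :
  dotS (fun i => W i - t *: U i) (fun i => W i - t *: U i) =
  dotS W W - 2 * t * dotS W U + t ^+ 2 * dotS U U.
Proof.
rewrite /dotS !mulr_sumr -sumrB -big_split/=; apply: eq_bigr => i _.
by rewrite !dotvE (dotvC (U i) (W i)); ring.
Qed.

Lemma cauchy_schwarzS W U : `|dotS W U| <= normS W * normS U.
Proof.
rewrite -sqrtr_sqr -sqrtrM ?dotS_ge0// ler_wsqrtr//.
by apply: sqr_le_of_quadratic (dotS_ge0 U) => t; rewrite -dotS_expand dotS_ge0.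
Qed.

Lemma ler_normSD W U : normS (fun i => W i + U i) <= normS W + normS U.
Proof.
rewrite -(@ler_pXn2r _ 2) ?nnegrE ?addr_ge0 ?normS_ge0//.
have -> : normS (fun i => W i + U i) ^+ 2 =
          normS W ^+ 2 + 2 * dotS W U + normS U ^+ 2.
  rewrite !normS_sqr /dotS mulr_sumr -!big_split/=; apply: eq_bigr => i _.
  by rewrite !dotvE (dotvC (U i) (W i)); ring.
by have := le_trans (ler_norm _) (cauchy_schwarzS W U); lra.
Qed.

End ProductSpace.

Lemma cauchy_schwarzv (R : realType) (d : nat) (x y : 'rV[R]_d) :
  dotv x y ^+ 2 <= dotv x x * dotv y y.
Proof.
apply: sqr_le_of_quadratic (dotv_ge0 y) => t.
have := dotv_ge0 (x - t *: y); rewrite !dotvE (dotvC y x).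
by congr (0 <= _); ring.
Qed.

(** * Conjugates of strongly convex functions *)

(* Convexity of [phi] with gradient [g], strengthened by the quantitative term
   equivalent to [1 / mu]-Lipschitz continuity of [g] (Baillon-Haddad). *)
Definition cocoercive (R : realType) (d : nat) (mu : R) (phi : 'rV[R]_d -> R)
    (g : 'rV[R]_d -> 'rV[R]_d) :=
  forall w v, phi w + dotv (v - w) (g w) +
    mu / 2 * dotv (g v - g w) (g v - g w) <= phi v.

Section Conjugate.
Variables (R : realType) (d : nat) (f : 'rV[R]_d -> \bar R) (mu : R).
Variable g : 'rV[R]_d -> 'rV[R]_d.
Hypothesis f_proper : proper_fun f.
Hypothesis f_sc : strongly_convex mu f.
Hypothesis gP : forall w x,
  ((dotv w x)%:E - f x <= (dotv w (g w))%:E - f (g w))%E.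

(** A point of the domain makes the maximum larger than [-oo], which excludes [f (g w) = +oo]. *)
Lemma argmax_fin w : f (g w) \is a fin_num.
Proof.
have [fNy [x fx]] := f_proper.
have := gP w x; rewrite fin_numE fNy/=.
case: (f (g w)) => //= ; move: (fNy x) fx.
by case: (f x).
Qed.

Lemma conjfE w : conjf f w = dotv w (g w) - fine (f (g w)).
Proof.
rewrite /conjf; have -> : ereal_sup [set ((dotv w x)%:E - f x)%E | x in setT]
    = ((dotv w (g w))%:E - f (g w))%E.
  apply/eqP; rewrite eq_le; apply/andP; split.
    by apply: ge_ereal_sup => _ [x _ <-]; exact: gP.
  by apply: ereal_sup_ubound; exists (g w).
by rewrite fineD ?fineN// ?fin_numN argmax_fin.
Qed.

Lemma fenchel_eq w : f (g w) = (dotv w (g w) - conjf f w)%:E.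
Proof. by rewrite conjfE subKr fineK// argmax_fin. Qed.

(** Fenchel-Young with a remainder: [g w] minimises the strongly convex function [f - <w, .>], which
    therefore grows quadratically away from [g w]. *)
Lemma fenchel_strong w x :
  ((dotv w x - conjf f w + mu / 2 * dotv (x - g w) (x - g w))%:E <= f x)%E.
Proof.
have [fNy _] := f_proper.
case fx : (f x) => [a||]; [|by rewrite leey|by have := fNy x; rewrite fx].
rewrite lee_fin; set y := g w; set D := dotv (x - y) (x - y).
have fy := fenchel_eq w; rewrite -/y in fy.
set b := dotv w y - conjf f w in fy.
have -> : dotv w x - conjf f w + mu / 2 * D = b + dotv w (x - y) + mu / 2 * D.
  by rewrite /b dotvBr; ring.
(* [f] grows quadratically along the segment from [y] to [x] up to a
   factor [1 - t], which disappears in the limit [t -> 0]. *)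
have key t : 0 < t < 1 -> mu / 2 * D <= a - b - dotv w (x - y) + t * (mu / 2 * D).
  move=> t01; have /andP[t0 t1] := t01.
  have := f_sc x y t01; rewrite fx fy !normv_sqr.
  set z := t *: x + (1 - t) *: y.
  have := gP w z; rewrite -/y fy.
  case fz : (f z) => [c||]; [|by rewrite /= ?leNye|by have := fNy z; rewrite fz].
  rewrite -!EFinB -!EFinM -!EFinD !lee_fin => h1 h2.
  have ez : dotv z z =
      t * dotv x x + (1 - t) * dotv y y - t * (1 - t) * D.
    by rewrite /D /z !dotvE (dotvC y x); ring.
  have ew : dotv w z = dotv w y + t * dotv w (x - y).
    by rewrite /z !dotvE; ring.
  rewrite -(ler_pM2l t0); rewrite ez in h2; rewrite ew in h1.
  by nra.
rewrite -lerBrDl; apply/ler_addgt0Pr => e e0.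
have D0 : 0 <= D by exact: dotv_ge0.
set K := mu / 2 * D in key *.
have K1 : 0 < 1 + `|K| by rewrite ltr_pwDl.
(* A point of the open unit interval with [m * K <= e]; the added 1 keeps the denominator positive
   when [K = 0]. *)
set m := Num.min (1 / 2) (e / (1 + `|K|)).
have m0 : 0 < m by rewrite /m lt_min [0 < e / _]divr_gt0// andbT; lra.
have m1 : m < 1 by rewrite /m gt_min (_ : 1 / 2 < 1 :> R)//; lra.
have := key m; rewrite m0 m1 => /(_ isT) /le_trans; apply.
suff : m * K <= e by lra.
have : m * (1 + `|K|) <= e by rewrite -ler_pdivlMr// ge_min lexx orbT.
have := ler_wpM2l (ltW m0) (ler_norm K); nra.
Qed.

(** The strong Fenchel inequality with slope [v] is taken at the maximiser [g w] of slope [w], where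
    the value of [f] is known exactly. *)
Lemma conjf_cocoercive : cocoercive mu (conjf f) g.
Proof.
move=> w v; have := fenchel_strong v (g w); rewrite fenchel_eq lee_fin => h.
by rewrite (dotv_distC (g v)) (dotvBl v w); lra.
Qed.

End Conjugate.

(** * Convexity, Lipschitz gradient and the descent inequality from cocoercivity *)

Section CocoerciveGradient.
Variables (R : realType) (d : nat) (phi : 'rV[R]_d -> R) (mu : R).
Variable g : 'rV[R]_d -> 'rV[R]_d.
Hypothesis mu0 : 0 < mu.
Hypothesis gP : cocoercive mu phi g.

Lemma coco_convex w v : phi w + dotv (v - w) (g w) <= phi v.
Proof.
apply: le_trans (gP w v); rewrite lerDl mulr_ge0 ?dotv_ge0//.
by rewrite divr_ge0 ?ltW.
Qed.

(** Adding the cocoercivity inequalities for [(w, v)] and [(v, w)] gives strong monotonicity in the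
    gradients; Cauchy-Schwarz then cancels one factor [G]. *)
Lemma coco_lipschitz w v :
  dotv (g v - g w) (g v - g w) <= mu^-1 ^+ 2 * dotv (v - w) (v - w).
Proof.
set G := dotv (g v - g w) (g v - g w); set W := dotv (v - w) (v - w).
have G0 : 0 <= G by exact: dotv_ge0.
have W0 : 0 <= W by exact: dotv_ge0.
have mono : mu * G <= dotv (v - w) (g v - g w).
  have := gP w v; have := gP v w.
  rewrite (dotv_distC (g w)) -/G !dotvE; lra.
have cs := cauchy_schwarzv (v - w) (g v - g w); rewrite -/G -/W in cs.
have [->|Gn0] := eqVneq G 0; first by rewrite mulr_ge0 ?sqr_ge0.
have Gp : 0 < G by rewrite lt_def Gn0.
have : (mu * G) ^+ 2 <= W * G.
  have mG0 : 0 <= mu * G by rewrite mulr_ge0// ltW.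
  by apply: le_trans cs; rewrite ler_pXn2r ?nnegrE// (le_trans mG0 mono).
rewrite exprMn (expr2 G) mulrA ler_pM2r// exprVn mulrC -ler_pdivlMr ?exprn_gt0//.
by rewrite mulrC.
Qed.

(** Cocoercivity based at [v] bounds [phi v] through the gradient at [v]. Passing to the gradient at
    [w] costs a cross term, absorbed by the remainder since [mu *: (g v - g w) - (v - w)] has
    nonnegative square. *)
Lemma coco_upper w v :
  phi v <= phi w + dotv (v - w) (g w) + mu^-1 / 2 * dotv (v - w) (v - w).
Proof.
have := gP v w.
have : dotv (v - w) (g v - g w) - mu / 2 * dotv (g w - g v) (g w - g v)
       <= mu^-1 / 2 * dotv (v - w) (v - w).
  have := dotv_ge0 (mu *: (g v - g w) - (v - w)).
  rewrite -(@pmulr_rge0 _ (mu^-1 / 2)) ?divr_gt0 ?invr_gt0//.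
  move=> h; rewrite -subr_ge0; move: h.
  congr (0 <= _); rewrite !dotvE (dotvC (g w) v) (dotvC (g v) v) (dotvC (g w) w) (dotvC (g v) w).
  rewrite (dotvC (g w) (g v)) (dotvC w v); field; exact: lt0r_neq0.
rewrite !dotvE; lra.
Qed.

End CocoerciveGradient.

(** * Existence of a dual minimiser *)

Section Continuity.
Variables (R : realType) (T : topologicalType).

Lemma continuous_sumr (I : Type) (r : seq I) (F : I -> T -> R) :
  (forall i, continuous (F i)) -> continuous (fun z => \sum_(i <- r) F i z).
Proof. by move=> cF z; apply: cvg_big => [|i _]; [exact: add_continuous|exact: cF]. Qed.

Lemma continuousDr (F G : T -> R) :
  continuous F -> continuous G -> continuous (fun z => F z + G z).
Proof. by move=> cF cG z; apply: cvgD; [exact: cF|exact: cG]. Qed.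

Lemma continuousMr (F G : T -> R) :
  continuous F -> continuous G -> continuous (fun z => F z * G z).
Proof. by move=> cF cG z; apply: cvgM; [exact: cF|exact: cG]. Qed.

Lemma continuous_dotv (d : nat) (F G : T -> 'rV[R]_d) :
  (forall i, continuous (fun z => F z 0 i)) ->
  (forall i, continuous (fun z => G z 0 i)) ->
  continuous (fun z => dotv (F z) (G z)).
Proof. by move=> cF cG; apply: continuous_sumr => i; exact: continuousMr. Qed.

Lemma closed_sublevel (F : T -> R) (c : R) :
  continuous F -> closed [set z | F z <= c].
Proof. by move=> /continuous_closedP/(_ _ (@closed_le _ c)). Qed.

(** The two bounds may depend on the point [z0]: this is what tangent minorants and quadratic
    majorants provide. *)
Lemma continuous_squeeze (F : T -> R) :
  (forall z0, exists lo up, [/\ continuous lo, continuous up,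
     (forall z, lo z <= F z <= up z), lo z0 = F z0 & up z0 = F z0]) ->
  continuous F.
Proof.
move=> H z0; have [lo [up [clo cup lFu lo0 up0]]] := H z0.
apply: (@squeeze_cvgr _ _ _ _ lo up); first by apply: nearW => z; exact: lFu.
  by rewrite -lo0; exact: clo.
by rewrite -up0; exact: cup.
Qed.

End Continuity.

Lemma rV_exists_min (R : realType) (N : nat) (F : 'rV[R]_N -> R)
    (A : set 'rV[R]_N) (M : R) :
  continuous F -> closed A -> A !=set0 ->
  (forall z, A z -> forall i, `|z 0 i| <= M) ->
  exists2 z, A z & forall t, A t -> F z <= F t.
Proof.
move=> cF cA A0 bA.
have cptA : compact A.
  apply: subclosed_compact cA (rV_compact (fun=> @segment_compact R (- M) M)) _.
  by move=> z Az i /=; rewrite in_itv/= -ler_norml bA.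
have [z zA zmin] := EVT_min_rV A0 cptA (continuous_subspaceT cF).
by exists z => [|t At]; [rewrite inE in zA|apply: zmin; rewrite inE].
Qed.

Section TotalCost.
Variables (R : realType) (n d : nat) (phi : 'I_n -> 'rV[R]_d -> R) (mu : R).
Variable g : 'I_n -> 'rV[R]_d -> 'rV[R]_d.
Hypothesis mu0 : 0 < mu.
Hypothesis gP : forall i, cocoercive mu (phi i) (g i).

Definition total_cost (W : 'I_n -> 'rV[R]_d) : R := \sum_i phi i (W i).

(** The extreme value theorem is applied on row vectors, so a family of [n] vectors is coded as one
    row of length [n * d]. *)
Definition unvec (z : 'rV[R]_(n * d)) (i : 'I_n) : 'rV[R]_d := row i (vec_mx z).

Lemma unvecE z i c : unvec z i 0 c = z 0 (mxvec_index i c).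
Proof. by rewrite !mxE. Qed.

Lemma unvec_surj (W : 'I_n -> 'rV[R]_d) : exists z, unvec z = W.
Proof.
exists (mxvec (\matrix_i W i)); apply/funext => i.
by rewrite /unvec mxvecK rowK.
Qed.

Lemma continuous_total : continuous (fun z => total_cost (unvec z)).
Proof.
apply: continuous_squeeze => z0.
have cdiff i c : continuous (fun z => (unvec z i - unvec z0 i) 0 c).
  rewrite (_ : (fun _ => _) = fun z : 'rV[R]_(n * d) =>
     z 0 (mxvec_index i c) + (- unvec z0 i 0 c)); last first.
    by apply/funext => z; rewrite !mxE.
  by apply: continuousDr; [exact: coord_continuous|exact: cst_continuous].
have ccst (v : 'rV[R]_d) c : continuous (fun _ : 'rV[R]_(n * d) => v 0 c).
  exact: cst_continuous.
pose lo z := \sum_i (phi i (unvec z0 i) +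
  dotv (unvec z i - unvec z0 i) (g i (unvec z0 i))).
pose up z := \sum_i (phi i (unvec z0 i) +
  dotv (unvec z i - unvec z0 i) (g i (unvec z0 i)) +
  mu^-1 / 2 * dotv (unvec z i - unvec z0 i) (unvec z i - unvec z0 i)).
have clo : continuous lo.
  apply: continuous_sumr => i; apply: continuousDr; first exact: cst_continuous.
  by apply: continuous_dotv => c; [exact: cdiff|exact: ccst].
have cup : continuous up.
  apply: continuous_sumr => i; apply: continuousDr.
    apply: continuousDr; first exact: cst_continuous.
    by apply: continuous_dotv => c; [exact: cdiff|exact: ccst].
  apply: continuousMr; first exact: cst_continuous.
  by apply: continuous_dotv => c; exact: cdiff.
exists lo, up; split => //.
- move=> z; rewrite !ler_sum// => i _; first exact: (coco_upper mu0 (gP i)).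
  exact: (coco_convex mu0 (gP i)).
- by apply: eq_bigr => i _; rewrite subrr dot0v addr0.
- by apply: eq_bigr => i _; rewrite subrr !dot0v mulr0 !addr0.
Qed.

Lemma total_exists_min (W0 : 'I_n -> 'rV[R]_d) (M : R) :
  \sum_i W0 i = 0 ->
  (forall W, \sum_i W i = 0 -> total_cost W <= total_cost W0 ->
     forall i c, `|W i 0 c| <= M) ->
  exists2 W, \sum_i W i = 0 &
    forall U, \sum_i U i = 0 -> total_cost W <= total_cost U.
Proof.
move=> W00 bnd.
pose s z := \sum_i unvec z i.
(* The zero-sum constraint is written as a sublevel set of a continuous function, so that closedness
   of both parts has the same proof. *)
pose A := [set z | dotv (s z) (s z) <= 0] `&` [set z | total_cost (unvec z) <= total_cost W0].
have sP z : dotv (s z) (s z) <= 0 <-> s z = 0.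
  split=> [sz|->]; last by rewrite dot0v.
  by apply: dotv_eq0; apply/eqP; rewrite eq_le sz dotv_ge0.
have cA : closed A.
  apply: closedI; apply: closed_sublevel; last exact: continuous_total.
  have cs c : continuous (fun z => s z 0 c).
    rewrite (_ : (fun _ => _) = fun z : 'rV[R]_(n * d) =>
       \sum_i z 0 (mxvec_index i c)); last first.
      by apply/funext => z; rewrite /s summxE; apply: eq_bigr => i _; rewrite unvecE.
    by apply: continuous_sumr => i; exact: coord_continuous.
  exact: continuous_dotv.
have A0 : A !=set0.
  have [z zE] := unvec_surj W0.
  by exists z; split; [apply/sP; rewrite /s zE|rewrite /= zE].
have bA z : A z -> forall k, `|z 0 k| <= M.
  move=> [/sP sz tz] k; case/mxvec_indexP: k => i c.
  by rewrite -unvecE; exact: bnd.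
have [z [/sP sz tz] zmin] := rV_exists_min continuous_total cA A0 bA.
exists (unvec z) => // U sU; have [tU|/ltW tU] := leP (total_cost U) (total_cost W0).
  by have [u uE] := unvec_surj U; rewrite -uE; apply: zmin; split;
     [apply/sP; rewrite /s uE|rewrite /= uE].
exact: le_trans tz tU.
Qed.

Definition mean (X : 'I_n -> 'rV[R]_d) : 'rV[R]_d := n%:R^-1 *: \sum_i X i.

Lemma sum_sub_mean X : (0 < n)%N -> \sum_i (X i - mean X) = 0.
Proof.
move=> n0; rewrite sumrB sumr_const card_ord /mean -scaler_nat scalerA.
by rewrite divff ?scale1r ?subrr// pnatr_eq0 -lt0n.
Qed.

(* A projected gradient step with step size [mu] must not decrease [total_cost]. *)
Lemma min_consensus (W : 'I_n -> 'rV[R]_d) : (0 < n)%N ->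
  \sum_i W i = 0 -> (forall U, \sum_i U i = 0 -> total_cost W <= total_cost U) ->
  forall i, g i (W i) = mean (fun i => g i (W i)).
Proof.
move=> n0 sW Wmin; set m := mean _.
pose e i := g i (W i) - m.
have se : \sum_i e i = 0 by exact: sum_sub_mean.
have := Wmin (fun i => W i - mu *: e i).
rewrite sumrB -scaler_sumr se scaler0 subr0 => /(_ sW) le1.
have : total_cost (fun i => W i - mu *: e i) <=
    total_cost W - mu / 2 * \sum_i dotv (e i) (e i).
  rewrite (_ : total_cost W - _ = \sum_i (phi i (W i) - mu * dotv (e i) (g i (W i))
     + mu / 2 * dotv (e i) (e i))); last first.
    rewrite big_split sumrB/= -!mulr_sumr.
    (* The [e i] sum to zero, so they pair to zero with the constant [m]. *)
    suff -> : \sum_i dotv (e i) (g i (W i)) = \sum_i dotv (e i) (e i).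
      by rewrite /total_cost; lra.
    transitivity (\sum_i (dotv (e i) (e i) + dotv (e i) m)).
      by apply: eq_bigr => i _; rewrite -dotvDr /e subrK.
    by rewrite big_split/= -dotv_suml se dot0v addr0.
  apply: ler_sum => i _.
  apply: le_trans (coco_upper mu0 (gP i) (W i) _) _.
  have -> : W i - mu *: e i - W i = - (mu *: e i) by rewrite addrAC subrr add0r.
  rewrite !dotvE.
  rewrite le_eqVlt; apply/orP; left; apply/eqP; field.
  by rewrite pnatr_eq0 -lt0n n0 gt_eqF.
move=> le2; have /eqP : \sum_i dotv (e i) (e i) = 0.
  apply/eqP; rewrite eq_le sumr_ge0 ?andbT => [|i _]; last exact: dotv_ge0.
  rewrite -(@pmulr_rle0 _ (mu / 2)) ?divr_gt0//.
  by have := le_trans le1 le2; lra.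
rewrite psumr_eq0 => [/allP e0|i _]; last exact: dotv_ge0.
move=> i; apply/eqP; rewrite -subr_eq0; apply/eqP/dotv_eq0.
by apply/eqP/e0; rewrite mem_index_enum.
Qed.

End TotalCost.

(** * Strong duality and primal bounds *)

Section Duality.
Variables (R : realType) (n d : nat) (f : 'I_n -> 'rV[R]_d -> \bar R) (mu : R).
Variable g : 'I_n -> 'rV[R]_d -> 'rV[R]_d.
Hypothesis mu0 : 0 < mu.
Hypothesis f_proper : forall i, proper_fun (f i).
Hypothesis f_sc : forall i, strongly_convex mu (f i).
Hypothesis gP : forall i w x,
  ((dotv w x)%:E - f i x <= (dotv w (g i w))%:E - f i (g i w))%E.

Let coco i : cocoercive mu (conjf (f i)) (g i).
Proof. exact: conjf_cocoercive. Qed.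

(** The strong Fenchel inequalities summed over the nodes. For zero-sum [W] and constant [X] the
    pairing vanishes, which leaves weak duality with a quadratic remainder. *)
Lemma Fval_lower W X :
  ((dotS W X - Dval f W + mu / 2 *
    dotS (fun i => X i - g i (W i)) (fun i => X i - g i (W i)))%:E <= Fval f X)%E.
Proof.
rewrite /dotS /Dval mulr_sumr -sumrB -big_split/= -sumEFin.
by apply: lee_sum => i _; apply: fenchel_strong.
Qed.

Lemma Fval_argmax W :
  Fval f (fun i => g i (W i)) = (dotS W (fun i => g i (W i)) - Dval f W)%:E.
Proof.
rewrite /Fval /dotS /Dval -sumrB -sumEFin.
by apply: eq_bigr => i _; exact: fenchel_eq.
Qed.

(* At an interior point [x0] of the domains, perturbing the [i]-th argument by
   [± r e_k] in the Fenchel inequalities bounds [r |W i 0 k|]. *)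
Lemma sublevel_bounded (c : R) :
  interior [set x | forall i, dom (f i) x] !=set0 ->
  exists M, forall W, \sum_i W i = 0 -> Dval f W <= c ->
    forall i k, `|W i 0 k| <= M.
Proof.
move=> [x0]; rewrite /interior/= => /nbhs_ballP[e /= e0 ballP].
pose r := e / 2; have r0 : 0 < r by rewrite divr_gt0.
pose q (a : R) (k : 'I_d) : 'rV[R]_d := x0 + a *: delta_mx 0 k.
have qdom a k l : `|a| <= r -> f l (q a k) \is a fin_num.
  move=> ar; have [fNy _] := f_proper l; rewrite fin_numE fNy /=.
  suff /ballP/(_ l) : ball x0 e (q a k) by rewrite /dom/= lt_neqAle => /andP[].
  rewrite -ball_normE /ball_/= /q opprD addrA subrr add0r normrN.
  rewrite (@le_lt_trans _ _ r)//; last by rewrite /r; lra.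
  rewrite /Num.norm/= mx_normrE; apply: bigmax_le; first exact: ltW.
  move=> [i j] _; rewrite !mxE/= normrM.
  by apply: le_trans ar; rewrite ler_piMr//; case: (_ && _); rewrite ?normr1 ?normr0.
(* One bound for [f l] at [x0] and at all its perturbations, whatever the coordinate and the
   sign. *)
pose K l := `|fine (f l x0)| +
  \sum_k (`|fine (f l (q r k))| + `|fine (f l (q (- r) k))|).
exists ((c + \sum_l K l) / r) => W sW Wc i k; rewrite ler_pdivlMr//.
(* The perturbation takes the sign of [W i 0 k], and only the [i]-th argument is moved; the
   contributions of [x0] cancel because [W] sums to zero. *)
pose s : R := if 0 <= W i 0 k then r else - r.
have sr : `|s| <= r by rewrite /s; case: ifP => _; rewrite ?normrN gtr0_norm.
pose a l : R := if l == i then s else 0.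
have ar l : `|a l| <= r by rewrite /a; case: eqP => // _; rewrite normr0 ltW.
have aK l : fine (f l (q (a l) k)) <= K l.
  apply: le_trans (ler_norm _) _; rewrite /a; case: eqP => _; last first.
    rewrite /q scale0r addr0 /K lerDl; apply: sumr_ge0 => j _.
    by rewrite addr_ge0.
  rewrite /K (bigD1 k)//= /s.
  have S0 : 0 <= \sum_(j < d | j != k)
      (`|fine (f l (q r j))| + `|fine (f l (q (- r) j))|).
    by apply: sumr_ge0 => j _; rewrite addr_ge0.
  have := normr_ge0 (fine (f l x0)); have := normr_ge0 (fine (f l (q r k))).
  by have := normr_ge0 (fine (f l (q (- r) k))); case: ifP => _; lra.
have : \sum_l (dotv (W l) (q (a l) k) - conjf (f l) (W l)) <= \sum_l K l.
  apply: ler_sum => l _; apply: le_trans (aK l).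
  rewrite -lee_fin fineK ?qdom//.
  apply: le_trans (fenchel_strong (f_proper l) (f_sc l) (gP l) (W l) (q (a l) k)).
  by rewrite lee_fin lerDl mulr_ge0 ?dotv_ge0// divr_ge0// ltW.
rewrite sumrB -/(Dval f W).
have -> : \sum_l dotv (W l) (q (a l) k) = r * `|W i 0 k|.
  have dk (v : 'rV[R]_d) : dotv v (delta_mx 0 k) = v 0 k.
    rewrite /dotv (bigD1 k)//= mxE !eqxx mulr1 big1 ?addr0// => j jk.
    by rewrite mxE (negPf jk) andbF mulr0.
  transitivity (\sum_l (dotv (W l) x0 + a l * W l 0 k)).
    by apply: eq_bigr => l _; rewrite !dotvE dk.
  rewrite big_split/= -dotv_suml sW dot0v add0r (bigD1 i)//= big1.
    rewrite addr0 /a eqxx /s; case: ifPn => W0; first by rewrite ger0_norm.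
    by rewrite ltr0_norm ?ltNge// mulNr mulrN.
  by move=> l li; rewrite /a (negPf li) mul0r.
rewrite mulrC; lra.
Qed.

Hypothesis n_gt0 : (0 < n)%N.
Hypothesis f_int : interior [set x | forall i, dom (f i) x] !=set0.

Lemma dual_optimum : exists Ws xb, [/\ \sum_i Ws i = 0,
  forall U, \sum_i U i = 0 -> Dval f Ws <= Dval f U &
  forall i, g i (Ws i) = xb].
Proof.
have [M MP] := sublevel_bounded (Dval f (fun=> 0)) f_int.
have s0 : \sum_(i < n) (0 : 'rV[R]_d) = 0 by rewrite big1.
have [Ws sWs Wmin] := total_exists_min mu0 coco s0 MP.
exists Ws, (mean (fun i => g i (Ws i))); split=> //.
exact: min_consensus mu0 coco _ n_gt0 sWs Wmin.
Qed.

Variable xstar : 'rV[R]_d.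
Hypothesis xstarP : forall x,
  (Fval f (fun _ => xstar) <= Fval f (fun _ => x))%E.

Lemma dotS_cst (W : 'I_n -> 'rV[R]_d) x :
  \sum_i W i = 0 -> dotS W (fun=> x) = 0.
Proof. by move=> sW; rewrite /dotS -dotv_suml sW dot0v. Qed.

(** The common gradient [xb] at a dual minimiser is a consensus point at which the Fenchel
    inequalities are equalities, so its primal value is [- Dstar f]. *)
Lemma strong_duality : exists Ws, [/\ \sum_i Ws i = 0,
  Dstar f = Dval f Ws,
  forall U, \sum_i U i = 0 -> Dstar f <= Dval f U,
  forall i, g i (Ws i) = xstar &
  Fstar f = (- Dstar f)%:E].
Proof.
have [Ws [xb [sWs Wmin gWs]]] := dual_optimum.
have DE : Dstar f = Dval f Ws.
  apply/eqP; rewrite eq_le; apply/andP; split.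
    by apply: ge_inf; [exists (Dval f Ws) => _ [U sU <-]; exact: Wmin|exists Ws].
  by apply: lb_le_inf; [exists (Dval f Ws), Ws|move=> _ [U sU <-]; exact: Wmin].
have gE : (fun i => g i (Ws i)) = fun=> xb by apply/funext.
have Fxb : Fval f (fun=> xb) = (- Dstar f)%:E.
  by rewrite -gE Fval_argmax gE dotS_cst// DE sub0r.
(* Since [xstar] does at least as well as [xb], the quadratic remainder of weak duality at [xstar]
   must vanish. *)
have xE : xb = xstar.
  have := le_trans (Fval_lower Ws (fun=> xstar)) (xstarP xb).
  rewrite Fxb lee_fin dotS_cst// DE sub0r gerDl pmulr_rle0 ?divr_gt0//.
  rewrite (_ : (fun i => _) = fun=> xstar - xb); last first.
    by apply/funext => i; rewrite gWs.
  move=> le0; have /eqP : dotS (fun _ : 'I_n => xstar - xb) (fun=> xstar - xb) = 0.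
    by apply/eqP; rewrite eq_le le0 dotS_ge0.
  rewrite psumr_eq0 => [/allP/(_ (Ordinal n_gt0))|i _]; last exact: dotv_ge0.
  by rewrite mem_index_enum => /(_ isT)/eqP/dotv_eq0/eqP; rewrite subr_eq0 => /eqP.
exists Ws; split=> //; first by move=> U sU; rewrite DE; exact: Wmin.
  by move=> i; rewrite gWs.
apply/eqP; rewrite eq_le; apply/andP; split.
  by apply: ereal_inf_lbound; exists xb.
by apply: le_ereal_inf_tmp => _ [x _ <-]; rewrite -Fxb xE.
Qed.

(** A real [sup] is an upper bound only of a bounded set; boundedness comes from the coordinate
    bound on the sublevel set. *)
Lemma R0_upper (W0 W U : 'I_n -> 'rV[R]_d) :
  S0 f W0 W -> S0 f W0 U -> normS (fun i => W i - U i) <= R0 f W0.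
Proof.
move=> SW SU; apply: ub_le_sup; last by exists W, U.
have [M MP] := sublevel_bounded (Dval f W0) f_int.
have bnd V : S0 f W0 V -> normS V <= Num.sqrt (\sum_(i < n) \sum_(k < d) M ^+ 2).
  move=> [DV sV]; apply: ler_wsqrtr; apply: ler_sum => i _; apply: ler_sum => k _.
  have Mk := MP _ sV DV i k.
  rewrite -expr2 -real_normK ?num_real// ler_pXn2r// ?nnegrE//.
  exact: le_trans Mk.
exists (2 * Num.sqrt (\sum_(i < n) \sum_(k < d) M ^+ 2)) => _ [V [V' [SV [SV' ->]]]].
have normN : normS (fun i => - V' i) = normS V'.
  by rewrite !normSE; congr Num.sqrt; apply: eq_bigr => i _; rewrite dotvNl dotvNr opprK.
apply: le_trans (ler_normSD _ _) _; rewrite normN mulr2n mulrDl mul1r.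
by apply: lerD; exact: bnd.
Qed.

(** [Fval_lower] at the optimal consensus point, whose value is [- Dstar f], leaves the quadratic
    remainder below the dual gap. *)
Lemma primal_dist W : \sum_i W i = 0 ->
  normS (fun i => g i (W i) - xstar) <=
  Num.sqrt (2 * mu^-1 * (Dval f W - Dstar f)).
Proof.
have [Ws [sWs DE Dmin gWs FE]] := strong_duality.
move=> sW; rewrite normSE ler_wsqrtr//.
have gE : (fun i => g i (Ws i)) = fun=> xstar by apply/funext.
have := Fval_lower W (fun=> xstar).
rewrite -[X in Fval f X]gE Fval_argmax gE lee_fin !dotS_cst// -DE.
rewrite (_ : dotS (fun i => xstar - _) _ =
  dotS (fun i => g i (W i) - xstar) (fun i => g i (W i) - xstar)); last first.
  by apply: eq_bigr => i _; rewrite dotv_distC.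
set Q := dotS _ _ => le1.
rewrite -(@ler_pM2l _ (mu / 2)) ?divr_gt0//.
have -> : mu / 2 * (2 * mu^-1 * (Dval f W - Dstar f)) = Dval f W - Dstar f.
  by field; exact: lt0r_neq0.
lra.
Qed.

(** With [X] the deviation from [xstar], the primal gap is at most [dotS W X] by the Fenchel
    equality at [W], and at least [dotS Ws X] by the Fenchel inequality at the dual optimum [Ws].
    Cauchy-Schwarz bounds both pairings. *)
Lemma primal_gap W0 W : \sum_i W0 i = 0 -> S0 f W0 W ->
  (`|Fval f (fun i => g i (W i)) - Fstar f| <=
    ((R0 f W0 + normS W0) * Num.sqrt (2 * mu^-1 * (Dval f W - Dstar f)))%:E)%E.
Proof.
move=> sW0 SW; have [DW sW] := SW.
have [Ws [sWs DE Dmin gWs FE]] := strong_duality.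
have SWs : S0 f W0 Ws by split=> //; rewrite -DE; exact: Dmin.
have SW0 : S0 f W0 W0 by [].
have nrm V : S0 f W0 V -> normS V <= R0 f W0 + normS W0.
  move=> SV; rewrite -[X in normS X](_ : (fun i => (V i - W0 i) + W0 i) = _).
    by apply: le_trans (ler_normSD _ _) _; rewrite lerD2r R0_upper.
  by apply/funext => i; rewrite subrK.
set X := fun i => g i (W i) - xstar.
have dX V : \sum_i V i = 0 -> dotS V (fun i => g i (W i)) = dotS V X.
  move=> sV; rewrite -[LHS]subr0 -(dotS_cst xstar sV) /dotS -sumrB.
  by apply: eq_bigr => i _; rewrite dotvBr.
have bnd V : S0 f W0 V -> `|dotS V X| <=
    (R0 f W0 + normS W0) * Num.sqrt (2 * mu^-1 * (Dval f W - Dstar f)).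
  move=> SV; apply: le_trans (cauchy_schwarzS _ _) _.
  by apply: ler_pM; rewrite ?normS_ge0 ?nrm ?primal_dist.
rewrite Fval_argmax FE -EFinB /abse lee_fin opprK dX//.
have := Fval_lower Ws (fun i => g i (W i)).
rewrite Fval_argmax lee_fin !dX// -DE => lo.
have := bnd _ SW; have := bnd _ SWs; rewrite !ler_norml => /andP[b1 b2] /andP[b3 b4].
have := Dmin _ sW.
set Q := dotS (fun i => _ - _) _ in lo.
have : 0 <= mu / 2 * Q by rewrite mulr_ge0 ?dotS_ge0// divr_ge0// ltW.
by move=> Q0 D0; apply/andP; split; lra.
Qed.

End Duality.

(** * The spectral gap of a connected graph *)

(* [[set j | e i j]] in [udeg] is a classical set, whose membership is an
   [asbool]. *)
Lemma udegE (n : nat) (e : rel 'I_n) i : udeg e i = #|e i|.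
Proof.
by apply: eq_card => j; apply/idP/idP => [/set_mem|ij]; last exact/mem_set.
Qed.

Section SpectralGap.
Variables (R : realType) (n : nat) (e : rel 'I_n).
Hypothesis e_sym : symmetric e.
Hypothesis e_irr : irreflexive e.
Hypothesis e_conn : graph_connected e.

Let Lap : 'M[R]_n := laplacian e.

Lemma mul_laplacianE (v : 'rV[R]_n) j :
  (v *m Lap) 0 j = \sum_(i | e j i) (v 0 j - v 0 i).
Proof.
rewrite mxE (bigD1 j)//= mxE eqxx sumrB sumr_const -[v 0 j *+ _]mulr_natr.
congr (_ * _ + _).
  by rewrite udegE.
rewrite -sumrN [RHS]big_mkcond [RHS](bigD1 j)//= e_irr add0r.
apply: eq_bigr => i /negPf ij; rewrite mxE ij e_sym.
by case: (e j i); rewrite ?mulrN1 // oppr0 mulr0.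
Qed.

(** Exchanging the ends of each edge symmetrises the sum; the factor 1/2 is there because the sum
    runs over ordered pairs. *)
Lemma laplacian_form (v u : 'rV[R]_n) : dotv (v *m Lap) u =
  2^-1 * \sum_i \sum_(j | e i j) (v 0 i - v 0 j) * (u 0 i - u 0 j).
Proof.
have -> : dotv (v *m Lap) u =
    \sum_i \sum_(j | e i j) (v 0 i - v 0 j) * u 0 i.
  by apply: eq_bigr => i _; rewrite mul_laplacianE mulr_suml.
set S := RHS; set T := LHS.
have swap : T = - \sum_i \sum_(j | e i j) (v 0 i - v 0 j) * u 0 j.
  rewrite /T (exchange_big_dep xpredT)//= -sumrN; apply: eq_bigr => i _.
  rewrite -sumrN; apply: eq_big => [j|j _]; first by rewrite e_sym.
  by rewrite -mulNr opprB.
rewrite /S; have -> : \sum_i \sum_(j | e i j) (v 0 i - v 0 j) * (u 0 i - u 0 j)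
   = T - \sum_i \sum_(j | e i j) (v 0 i - v 0 j) * u 0 j.
  rewrite /T -sumrB; apply: eq_bigr => i _; rewrite -sumrB.
  by apply: eq_bigr => j _; rewrite mulrBr.
by rewrite -swap; field.
Qed.

Lemma laplacian_psd (v : 'rV[R]_n) : 0 <= dotv (v *m Lap) v.
Proof.
rewrite laplacian_form mulr_ge0//; apply: sumr_ge0 => i _.
by apply: sumr_ge0 => j _; rewrite -expr2 sqr_ge0.
Qed.

Lemma laplacian_formC (v u : 'rV[R]_n) :
  dotv (v *m Lap) u = dotv (u *m Lap) v.
Proof.
rewrite !laplacian_form; congr (_ * _); apply: eq_bigr => i _.
by apply: eq_bigr => j _; rewrite mulrC.
Qed.

Lemma laplacian_sum0 (v : 'rV[R]_n) : \sum_i (v *m Lap) 0 i = 0.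
Proof.
have -> : \sum_i (v *m Lap) 0 i = dotv (v *m Lap) (const_mx 1).
  by apply: eq_bigr => i _; rewrite [const_mx _ _ _]mxE mulr1.
rewrite laplacian_form big1 ?mulr0// => i _; rewrite big1// => j _.
by rewrite !mxE subrr mulr0.
Qed.

(** Zero energy forces equality along edges, hence by connectivity a constant vector, and a zero-sum
    constant is zero. *)
Lemma laplacian_ker (v : 'rV[R]_n) : dotv (v *m Lap) v = 0 ->
  \sum_i v 0 i = 0 -> v = 0.
Proof.
rewrite laplacian_form => /eqP; rewrite mulf_eq0 invr_eq0 pnatr_eq0/=.
have sqs i j : 0 <= (v 0 i - v 0 j) * (v 0 i - v 0 j) by rewrite -expr2 sqr_ge0.
rewrite psumr_eq0 => [|i _]; last by apply: sumr_ge0.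
move=> /allP v0 sv.
have edge i j : e i j -> v 0 i = v 0 j.
  move=> eij; have := v0 i; rewrite mem_index_enum => /(_ isT)/=.
  rewrite psumr_eq0// => /allP/(_ j); rewrite mem_index_enum eij => /(_ isT)/=.
  by rewrite mulf_eq0 orbb subr_eq0 => /eqP.
have cst i j : v 0 i = v 0 j.
  have /connectP[p + ->] := e_conn i j.
  elim: p i => //= k p IH i /andP[/edge -> kp]; exact: IH.
apply/rowP => i; rewrite mxE.
move: sv; rewrite (eq_bigr (fun=> v 0 i)) => [|j _]; last exact: cst.
rewrite sumr_const card_ord => /eqP; rewrite mulrn_eq0 => /orP[|/eqP//].
by rewrite -leqn0 leqNgt (leq_ltn_trans (leq0n i) (ltn_ord i)).
Qed.

Lemma lambda_min_nz_ge0 : 0 <= lambda_min_nz Lap.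
Proof.
have lb : lbound [set a : R | a != 0 /\ eigenvalue Lap a] 0.
  move=> a [_ /eigenvalueP[v vE v0]].
  have := laplacian_psd v; rewrite vE dotvZl pmulr_lge0// lt_def dotv_ge0 andbT.
  by apply: contra v0 => /eqP/dotv_eq0/eqP.
rewrite /lambda_min_nz; set A := [set a | _] in lb *.
(* Without a nonzero eigenvalue, as for a single vertex, the infimum takes its default value 0. *)
have [A0|/nonemptyPn ->] := pselect (A !=set0); last by rewrite inf0.
exact: lb_le_inf.
Qed.

(* The infimum of the Rayleigh quotient over the zero-sum vectors is attained
   and its minimiser is an eigenvector. *)
Lemma rayleigh_min (x : 'rV[R]_n) : \sum_i x 0 i = 0 -> x != 0 ->
  exists m, [/\ m != 0, eigenvalue Lap m &
    forall y : 'rV[R]_n, \sum_i y 0 i = 0 -> m * dotv y y <= dotv (y *m Lap) y].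
Proof.
move=> sx x0.
(* The unit sphere of the zero-sum hyperplane, as a single sublevel set. *)
pose A := [set z : 'rV[R]_n | (\sum_i z 0 i) ^+ 2 + (dotv z z - 1) ^+ 2 <= 0].
have AP z : A z <-> \sum_i z 0 i = 0 /\ dotv z z = 1.
  split=> [Az|[zs z1]]; last by rewrite /A/= zs z1 subrr expr0n addr0.
  have /eqP : (\sum_i z 0 i) ^+ 2 + (dotv z z - 1) ^+ 2 = 0.
    by apply/eqP; rewrite eq_le addr_ge0 ?sqr_ge0// andbT.
  rewrite paddr_eq0 ?sqr_ge0// !expf_eq0/= subr_eq0.
  by move=> /andP[/eqP ? /eqP ?].
have cE i : continuous (fun z : 'rV[R]_n => z 0 i) by exact: coord_continuous.
have cs : continuous (fun z : 'rV[R]_n => \sum_i z 0 i).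
  by apply: continuous_sumr.
have cd : continuous (fun z : 'rV[R]_n => dotv z z - 1).
  by apply: continuousDr; [exact: continuous_dotv|exact: cst_continuous].
have clA : closed A.
  by apply: closed_sublevel; apply: continuousDr; exact: continuousMr.
have normA (y : 'rV[R]_n) : \sum_i y 0 i = 0 -> y != 0 ->
    exists2 a, a != 0 & A (a *: y) /\ a ^+ 2 = (dotv y y)^-1.
  move=> sy y0.
  have yy : 0 < dotv y y.
    by rewrite lt_def dotv_ge0 andbT; apply: contra y0 => /eqP/dotv_eq0/eqP.
  have sq : ((Num.sqrt (dotv y y))^-1) ^+ 2 = (dotv y y)^-1.
    by rewrite exprVn sqr_sqrtr// ltW.
  exists (Num.sqrt (dotv y y))^-1; first by rewrite invr_eq0 gt_eqF// sqrtr_gt0.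
  split=> //; apply/AP; split.
    by under eq_bigr do rewrite mxE; rewrite -mulr_sumr sy mulr0.
  by rewrite !dotvE mulrA -expr2 sq mulVf// gt_eqF.
have A0 : A !=set0 by have [a _ [Ax _]] := normA x sx x0; exists (a *: x).
have bA z : A z -> forall i, `|z 0 i| <= 1.
  move=> /AP[_ z1] i; rewrite -(@ler_pXn2r _ 2)// ?nnegrE// expr1n -z1.
  rewrite real_normK ?num_real// /dotv (bigD1 i)//= expr2 lerDl.
  by apply: sumr_ge0 => j _; rewrite -expr2 sqr_ge0.
pose Q (z : 'rV[R]_n) := dotv (z *m Lap) z.
have cQ : continuous Q.
  apply: continuous_dotv => // i.
  rewrite (_ : (fun _ => _) = fun z : 'rV[R]_n => \sum_j z 0 j * Lap j i).
    apply: continuous_sumr => j; apply: continuousMr => //; exact: cst_continuous.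
  by apply/funext => z; rewrite mxE.
have [z Az zmin] := rV_exists_min cQ clA A0 bA.
have /AP[sz z1] := Az.
have ray (y : 'rV[R]_n) : \sum_i y 0 i = 0 -> Q z * dotv y y <= Q y.
  move=> sy; have [->|y0] := eqVneq y 0.
    by rewrite /Q mul0mx !dot0v mulr0.
  have [a a0 [Ay a2]] := normA y sy y0.
  have := zmin _ Ay; rewrite {2}/Q -scalemxAl !dotvE mulrA -expr2 a2 mulrC.
  rewrite ler_pdivlMr// lt_def dotv_ge0 andbT.
  by apply: contra y0 => /eqP/dotv_eq0/eqP.
exists (Q z); split=> //.
  apply: contraTneq (lexx (1 : R)) => /laplacian_ker/(_ sz) zE.
  by move: z1; rewrite zE dot0v => /esym/eqP; rewrite oner_eq0.
(* The residual of the eigenvalue equation, itself a zero-sum vector. *)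
have [y yE] : exists y, y = z *m Lap - Q z *: z by exists (z *m Lap - Q z *: z).
have sy : \sum_i y 0 i = 0.
  rewrite yE (eq_bigr (fun i => (z *m Lap) 0 i - Q z * z 0 i)).
    by rewrite sumrB laplacian_sum0 -mulr_sumr sz mulr0 subrr.
  by move=> i _; rewrite !mxE.
(* First-order condition: along [z - t *: y] the quadratic [Q - Q z * |.|^2] is nonnegative and
   vanishes at [t = 0], so its linear coefficient is zero. It says that [y] is orthogonal to
   itself. *)
have crit : dotv (z *m Lap) y - Q z * dotv z y = 0.
  apply/eqP; rewrite -sqrf_eq0 eq_le sqr_ge0 andbT.
  rewrite -(mul0r (Q y - Q z * dotv y y)).
  apply: sqr_le_of_quadratic; last by rewrite subr_ge0 ray.
  move=> t; have : \sum_i (z - t *: y) 0 i = 0.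
    rewrite (eq_bigr (fun i => z 0 i - t * y 0 i)).
      by rewrite sumrB -mulr_sumr sz sy mulr0 subrr.
    by move=> i _; rewrite !mxE.
  move=> /ray; rewrite -subr_ge0; congr (0 <= _).
  rewrite {1}/Q mulmxBl -scalemxAl !dotvE (laplacian_formC y z) (dotvC y z) z1.
  by rewrite -/(Q z) -/(Q y); ring.
apply/eigenvalueP; exists z; last first.
  by apply: contra_eq_neq z1 => ->; rewrite dot0v eq_sym oner_eq0.
apply/eqP; rewrite -subr_eq0 -yE; apply/eqP/dotv_eq0.
by rewrite {1}yE dotvBl dotvZl.
Qed.

Lemma spectral_gap (x : 'rV[R]_n) : \sum_i x 0 i = 0 ->
  lambda_min_nz Lap * dotv x x <= dotv (x *m Lap) x.
Proof.
move=> sx; have [->|x0] := eqVneq x 0; first by rewrite mul0mx !dot0v mulr0.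
have [m [m0 em /(_ x sx)]] := rayleigh_min sx x0.
apply: le_trans; rewrite ler_wpM2r ?dotv_ge0//; apply: ge_inf => //.
exists 0 => a [_ /eigenvalueP[v vE v0]].
have := laplacian_psd v; rewrite vE dotvZl pmulr_lge0// lt_def dotv_ge0 andbT.
by apply: contra v0 => /eqP/dotv_eq0/eqP.
Qed.

(** The scalar gap is applied to each coordinate [Y c] of the deviations from the mean; the mean
    cancels in differences along edges. *)
Lemma spectral_gapS (d : nat) (X : 'I_n -> 'rV[R]_d) : (0 < n)%N ->
  lambda_min_nz Lap * dotS (fun i => X i - mean X) (fun i => X i - mean X) <=
  2^-1 * \sum_i \sum_(j | e i j) dotv (X i - X j) (X i - X j).
Proof.
move=> n0; pose Y c : 'rV[R]_n := \row_i (X i - mean X) 0 c.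
have sY c : \sum_i Y c 0 i = 0.
  under eq_bigr do rewrite mxE.
  by rewrite -summxE sum_sub_mean// mxE.
have -> : dotS (fun i => X i - mean X) (fun i => X i - mean X) =
    \sum_c dotv (Y c) (Y c).
  rewrite /dotS /dotv exchange_big/=; apply: eq_bigr => c _.
  by apply: eq_bigr => i _; rewrite !mxE.
have -> : 2^-1 * \sum_i \sum_(j | e i j) dotv (X i - X j) (X i - X j) =
    \sum_c dotv (Y c *m Lap) (Y c).
  under [RHS]eq_bigr do rewrite laplacian_form.
  rewrite -mulr_sumr exchange_big/=; congr (_ * _); apply: eq_bigr => i _.
  rewrite exchange_big/=; apply: eq_bigr => j _; apply: eq_bigr => c _.
  by rewrite !mxE; congr (_ * _); ring.
by rewrite mulr_sumr; apply: ler_sum => c _; apply: spectral_gap.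
Qed.

End SpectralGap.

(** * One iteration *)

Lemma edge_sum_swap (V : zmodType) (n : nat) (e : rel 'I_n)
    (F : 'I_n -> 'I_n -> V) : symmetric e ->
  \sum_i \sum_(j | e i j) F i j = \sum_i \sum_(j | e i j) F j i.
Proof.
move=> es; rewrite (exchange_big_dep xpredT)//=; apply: eq_bigr => i _.
by apply: eq_bigl => j; rewrite es.
Qed.

Section AveragingStep.
Variables (R : realType) (n d : nat) (phi : 'I_n -> 'rV[R]_d -> R) (mu : R).
Variable g : 'I_n -> 'rV[R]_d -> 'rV[R]_d.
Hypothesis mu0 : 0 < mu.
Hypothesis gP : forall i, cocoercive mu (phi i) (g i).
Variables (e : rel 'I_n) (h : 'I_n -> 'I_n -> R).
Hypothesis e_sym : symmetric e.
Hypothesis h_sym : forall i j, e i j -> h i j = h j i.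
Hypothesis h_ge0 : forall i j, e i j -> 0 <= h i j.
Hypothesis h_sum : forall i, \sum_(j | e i j) h i j <= 1.
Variables (W : 'I_n -> 'rV[R]_d) (U : 'I_n -> 'I_n -> 'rV[R]_d).

Let W' i := (1 - \sum_(j | e i j) h i j) *: W i + \sum_(j | e i j) h i j *: U i j.

Lemma avg_stepE i : W' i - W i = \sum_(j | e i j) h i j *: (U i j - W i).
Proof.
under eq_bigr do rewrite scalerBr.
by rewrite sumrB -scaler_suml /W' scalerBl scale1r addrAC [W i - _ - _]addrAC subrr add0r addrC.
Qed.

Lemma avg_step_move :
  dotS (fun i => W' i - W i) (fun i => W' i - W i) <=
  \sum_i \sum_(j | e i j) h i j * dotv (U i j - W i) (U i j - W i).
Proof.
apply: ler_sum => i _; rewrite avg_stepE; apply: dotv_sum_le => //.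
by move=> j; exact: h_ge0.
Qed.

(** Jensen's inequality through the tangent at [W' i]: the linear terms cancel because [W' i] is the
    weighted average of [W i] and the [U i j]. *)
Lemma avg_step_convex : total_cost phi W' - total_cost phi W <=
  \sum_i \sum_(j | e i j) h i j * (phi i (U i j) - phi i (W i)).
Proof.
rewrite /total_cost -sumrB; apply: ler_sum => i _.
set G := g i (W' i); set H := \sum_(j | e i j) h i j.
have UW j : e i j -> h i j * (phi i (W' i) + dotv (U i j - W' i) G) <=
    h i j * phi i (U i j).
  by move=> eij; rewrite ler_wpM2l ?h_ge0//; exact: (coco_convex mu0 (gP i)).
have WW : (1 - H) * (phi i (W' i) + dotv (W i - W' i) G) <= (1 - H) * phi i (W i).
  by rewrite ler_wpM2l ?subr_ge0 ?h_sum//; exact: (coco_convex mu0 (gP i)).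
have aux (a p : R) (x y z v : 'rV[R]_d) : a * (p + dotv (x - z) v) =
    a * (p + dotv (y - z) v) + dotv (a *: (x - y)) v by rewrite !dotvE; ring.
have := ler_sum (index_enum 'I_n) UW.
rewrite (eq_bigr (fun j => h i j * (phi i (W' i) + dotv (W i - W' i) G) +
    dotv (h i j *: (U i j - W i)) G)); last first.
  by move=> j _; exact: aux.
rewrite big_split/= -mulr_suml -/H -dotv_suml -avg_stepE => UU.
under eq_bigr do rewrite mulrBr.
rewrite sumrB -mulr_suml -/H.
have : dotv (W' i - W i) G + dotv (W i - W' i) G = 0.
  by rewrite -dotvDl addrA subrK subrr dot0v.
lra.
Qed.

(** The convexity bound is added to its copy with edge ends exchanged, so that the changes at both
    ends of an edge appear together; this doubling is the source of the factor 1/2. *)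
Lemma avg_step_descent (q : 'I_n -> 'I_n -> R) :
  (forall i j, e i j -> phi i (U i j) + phi j (U j i) - phi i (W i) - phi j (W j)
     <= - q i j) ->
  2^-1 * \sum_i \sum_(j | e i j) h i j * q i j <= total_cost phi W - total_cost phi W'.
Proof.
move=> qP; have := avg_step_convex; set S := \sum_i _ => le1.
have SE : S = \sum_i \sum_(j | e i j) h i j * (phi j (U j i) - phi j (W j)).
  rewrite /S edge_sum_swap//; apply: eq_bigr => i _; apply: eq_bigr => j eij.
  by rewrite (h_sym eij).
have : S + S <= - \sum_i \sum_(j | e i j) h i j * q i j.
  rewrite {2}SE -big_split -sumrN; apply: ler_sum => i _ /=.
  rewrite -big_split -sumrN; apply: ler_sum => j eij /=.
  rewrite -mulrDr -mulrN; apply: ler_wpM2l; first exact: h_ge0.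
  by have := qP i j eij; lra.
lra.
Qed.

Lemma avg_step_sum :
  (forall i j, e i j -> U i j + U j i = W i + W j) -> \sum_i W' i = \sum_i W i.
Proof.
move=> UW; apply/eqP; rewrite -subr_eq0 -sumrB; apply/eqP.
under eq_bigr do rewrite avg_stepE.
set S := \sum_i _; suff : S + S = 0.
  by rewrite -mulr2n => /eqP; rewrite -scaler_nat scaler_eq0 pnatr_eq0 => /eqP.
rewrite {2}/S edge_sum_swap// -big_split big1//= => i _.
rewrite -big_split big1//= => j eij.
rewrite (h_sym eij) -scalerDr; have -> : U i j - W i + (U j i - W j) = 0.
  by rewrite addrACA UW// -opprD subrr.
by rewrite scaler0.
Qed.

End AveragingStep.

(** * The update of a single edge *)

Section Safeguard.
Variables (R : realType) (d : nat) (phi psi : 'rV[R]_d -> R) (mu : R).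
Variables (g k : 'rV[R]_d -> 'rV[R]_d) (s1 : bool) (c1 c2 beta : R).
Hypothesis mu0 : 0 < mu.
Hypothesis gP : cocoercive mu phi g.
Hypothesis kP : cocoercive mu psi k.
Implicit Types x y u v : 'rV[R]_d.

(** The quantity tested by (S2) dominates the one tested by (S1). *)
Lemma coco_upper2 x y u v : phi u + psi v - phi x - psi y <=
  dotv (g x) (u - x) + mu^-1 / 2 * dotv (u - x) (u - x) +
  dotv (k y) (v - y) + mu^-1 / 2 * dotv (v - y) (v - y).
Proof.
have := coco_upper mu0 gP x u; have := coco_upper mu0 kP y v.
rewrite (dotvC (v - y) (k y)) (dotvC (u - x) (g x)); lra.
Qed.

Hypothesis betaP : 0 < beta < mu^-1^-1.
Let theta1 := Num.min (beta * (1 - beta * mu^-1)) c1.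
Let theta2 := Num.min ((beta^-1 - mu^-1) / 2) c2.

(** The majorant equals [- beta * (1 - beta * mu^-1) * |G|^2]. As the squared displacement is
    [2 * beta ^+ 2 * |G|^2], it is also [- (beta^-1 - mu^-1) / 2] times that displacement. *)
Lemma gradient_exchange_descent x y :
  let G := g x - k y in
  let u := x - beta *: G in let v := y + beta *: G in
  phi u + psi v - phi x - psi y <= - (theta1 * dotv G G) /\
  phi u + psi v - phi x - psi y <=
    - (theta2 * (dotv (u - x) (u - x) + dotv (v - y) (v - y))).
Proof.
move=> G u v; have /andP[b0 _] := betaP.
have ux : u - x = - beta *: G by rewrite /u addrAC subrr add0r scaleNr.
have vy : v - y = beta *: G by rewrite /v addrAC subrr add0r.
have G0 := dotv_ge0 G.
have le1 : phi u + psi v - phi x - psi y <=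
    - (beta * (1 - beta * mu^-1) * dotv G G).
  apply: le_trans (coco_upper2 x y u v) _; rewrite ux vy !dotvZl !dotvZr.
  have -> : dotv (g x) G = dotv G G + dotv (k y) G by rewrite -dotvDl subrK.
  lra.
split; apply: le_trans le1 _; rewrite lerN2.
  by rewrite ler_wpM2r// ge_min lexx.
rewrite ux vy !dotvZl !dotvZr.
apply: (@le_trans _ _ ((beta^-1 - mu^-1) / 2 *
    (- beta * (- beta * dotv G G) + beta * (beta * dotv G G)))).
  rewrite ler_wpM2r ?ge_min ?lexx//.
  by rewrite !mulNr mulrN opprK -mulr2n mulrn_wge0// !mulr_ge0// ltW.
rewrite le_eqVlt; apply/orP; left; apply/eqP; field.
by rewrite !gt_eqF.
Qed.

End Safeguard.

(* The safeguard test (S1) or (S2) of [half_step], on the pair [(x, y)] with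
   candidate [(u, v)]. *)
Definition safeguard (R : realType) (d : nat) (s1 : bool)
    (phi psi : 'rV[R]_d -> R) (g k : 'rV[R]_d -> 'rV[R]_d) (L c1 c2 : R)
    (x y u v : 'rV[R]_d) : bool :=
  let rho := Num.min (- (c1 * normv (g x - k y) ^+ 2))
                     (- (c2 * (normv (u - x) ^+ 2 + normv (v - y) ^+ 2))) in
  if s1 then phi u + psi v - phi x - psi y <= rho
  else dotv (g x) (u - x) + L / 2 * normv (u - x) ^+ 2 +
       dotv (k y) (v - y) + L / 2 * normv (v - y) ^+ 2 <= rho.

(** Each end of an edge evaluates the test in its own order; the two verdicts must agree. *)
Lemma safeguardC (R : realType) (d : nat) s1 (phi psi : 'rV[R]_d -> R) g k
    L c1 c2 x y u v :
  safeguard s1 phi psi g k L c1 c2 x y u v = safeguard s1 psi phi k g L c1 c2 y x v u.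
Proof.
rewrite /safeguard !normv_sqr (dotv_distC (g x)).
rewrite (addrC (dotv (v - y) (v - y))).
by case: s1; congr (_ <= _); ring.
Qed.

Lemma safeguard_descent (R : realType) (d : nat) s1 (phi psi : 'rV[R]_d -> R)
    mu g k c1 c2 x y u v :
  0 < mu -> cocoercive mu phi g -> cocoercive mu psi k ->
  safeguard s1 phi psi g k mu^-1 c1 c2 x y u v ->
  phi u + psi v - phi x - psi y <= - (c1 * dotv (g x - k y) (g x - k y)) /\
  phi u + psi v - phi x - psi y <=
    - (c2 * (dotv (u - x) (u - x) + dotv (v - y) (v - y))).
Proof.
move=> mu0 gP kP; rewrite /safeguard !normv_sqr.
case: s1; rewrite le_min => /andP[]; first by [].
by split; apply: le_trans (coco_upper2 mu0 gP kP x y u v) _.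
Qed.

(** * One block of iterations *)

Section BlockEstimate.
Variables (R : realType) (n d : nat).
Variable g : 'I_n -> 'rV[R]_d -> 'rV[R]_d.
Variables (E : nat -> rel 'I_n) (W : nat -> 'I_n -> 'rV[R]_d) (V : nat -> R).
Variables (L a b eta : R) (B K : nat).
Hypothesis B_gt0 : (0 < B)%N.
Hypothesis E_sym : forall k, symmetric (E k).
Hypothesis g_lip : forall i x y,
  dotv (g i y - g i x) (g i y - g i x) <= L ^+ 2 * dotv (y - x) (y - x).
Hypotheses (a_gt0 : 0 < a) (b_gt0 : 0 < b).
Hypothesis edge_descent : forall k, a * (2^-1 * \sum_i \sum_(j | E k i j)
  dotv (g i (W k i) - g j (W k j)) (g i (W k i) - g j (W k j))) <= V k - V k.+1.
Hypothesis move_descent : forall k, b *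
  dotS (fun i => W k.+1 i - W k i) (fun i => W k.+1 i - W k i) <= V k - V k.+1.
Hypothesis eta_ge0 : 0 <= eta.
Hypothesis eta_deg : forall i, (udeg (union_edges E B K) i)%:R <= eta.

Let x k i := g i (W k i).
Let M i := \sum_(r < B) dotv (W (K + r).+1 i - W (K + r) i) (W (K + r).+1 i - W (K + r) i).
Let U := union_edges E B K.

(** The drift is a sum of at most [B] increments; convexity of the squared norm with weights
    [1 / B], applied to increments scaled by [B], costs the factor [B]. *)
Lemma block_drift (s : 'I_B) i :
  dotv (x (K + s) i - x K i) (x (K + s) i - x K i) <= L ^+ 2 * (B%:R * M i).
Proof.
apply: le_trans (g_lip i (W K i) (W (K + s) i)) _.
rewrite ler_wpM2l ?sqr_ge0//.
pose D r := W (K + r).+1 i - W (K + r) i.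
have B0 : 0 < B%:R :> R by rewrite ltr0n.
have -> : W (K + s)%N i - W K i =
    \sum_(r < B | (r < s)%N) B%:R^-1 *: (B%:R *: D r).
  rewrite (eq_bigr (fun r : 'I_B => D r)) => [|r _]; last first.
    by rewrite scalerA mulVf ?scale1r// gt_eqF.
  rewrite -(big_ord_widen _ D (ltnW (ltn_ord s))) -(big_mkord xpredT D).
  have := telescope_sumr (fun r => W (K + r)%N i) (leq0n s).
  by rewrite addn0 => <-; apply: eq_bigr => r _; rewrite /D addnS.
apply: le_trans (dotv_sum_le _ _ _) _.
- by move=> r _; rewrite invr_ge0 ltW.
- rewrite sumr_const -[_ *+ _]mulr_natl ler_pdivrMr// mul1r ler_nat.
  by rewrite (leq_trans (max_card _))// card_ord.
rewrite /M mulr_sumr big_mkcond; apply: ler_sum => r _; case: ifP => _.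
  by rewrite !dotvE mulrA mulVf ?mul1r ?gt_eqF.
by rewrite mulr_ge0 ?dotv_ge0// ltW.
Qed.

Lemma block_edge i j : U i j ->
  dotv (x K i - x K j) (x K i - x K j) <=
  3 * (\sum_(r < B | E (K + r) i j)
    dotv (x (K + r) i - x (K + r) j) (x (K + r) i - x (K + r) j)) +
  3 * (L ^+ 2 * (B%:R * M i) + L ^+ 2 * (B%:R * M j)).
Proof.
move=> /existsP[s eij]; rewrite (bigD1 s)//=.
have S0 : 0 <= \sum_(r < B | E (K + r) i j && (r != s))
    dotv (x (K + r) i - x (K + r) j) (x (K + r) i - x (K + r) j).
  by apply: sumr_ge0 => r _; exact: dotv_ge0.
have di := block_drift s i; have dj := block_drift s j.
suff : dotv (x K i - x K j) (x K i - x K j) <=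
  3 * dotv (x (K + s) i - x (K + s) j) (x (K + s) i - x (K + s) j) +
  3 * (dotv (x (K + s) i - x K i) (x (K + s) i - x K i) +
       dotv (x (K + s) j - x K j) (x (K + s) j - x K j)) by lra.
(* The difference of the two sides is [|u + v|^2 + |u - t|^2 + |v + t|^2]. *)
have three (u v t : 'rV[R]_d) : dotv (u - v + t) (u - v + t) <=
    3 * dotv u u + 3 * (dotv v v + dotv t t).
  have := dotv_ge0 (u + v); have := dotv_ge0 (u - t); have := dotv_ge0 (v + t).
  by rewrite !dotvE (dotvC v u) (dotvC t u) (dotvC t v); lra.
rewrite (_ : x K i - x K j = x (K + s)%N i - x (K + s)%N j -
  (x (K + s)%N i - x K i) + (x (K + s)%N j - x K j)); first exact: three.
by rewrite [in RHS]opprB !addrA; apply/rowP => c; rewrite !mxE; ring.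
Qed.

Lemma block_estimate :
  2^-1 * \sum_i \sum_(j | U i j) dotv (x K i - x K j) (x K i - x K j) <=
  (3 * B%:R * L ^+ 2 * eta / b + 3 / a) * (V K - V (K + B)%N).
Proof.
have U_sym : symmetric U.
  by move=> i j; apply/existsP/existsP => -[r]; rewrite E_sym; exists r.
have VE : V K - V (K + B)%N = \sum_(r < B) (V (K + r)%N - V (K + r).+1).
  rewrite -(big_mkord xpredT (fun r => V (K + r)%N - V (K + r).+1)).
  have := telescope_sumr (fun r => - V (K + r)%N) (leq0n B).
  rewrite addn0 opprK addrC => <-; apply: eq_bigr => r _.
  by rewrite opprK addrC addnS.
have M0 i : 0 <= M i by apply: sumr_ge0 => r _; exact: dotv_ge0.
have sumM : b * \sum_i M i <= V K - V (K + B)%N.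
  rewrite VE /M exchange_big mulr_sumr; apply: ler_sum => r _.
  exact: move_descent.
have sumE : a * (2^-1 * \sum_i \sum_(j | U i j) \sum_(r < B | E (K + r) i j)
    dotv (x (K + r) i - x (K + r) j) (x (K + r) i - x (K + r) j))
    <= V K - V (K + B)%N.
  rewrite VE (_ : \sum_i _ = \sum_(r < B) \sum_i \sum_(j | E (K + r)%N i j)
    dotv (x (K + r) i - x (K + r) j) (x (K + r) i - x (K + r) j)).
    by rewrite 2!mulr_sumr; apply: ler_sum => r _; exact: edge_descent.
  rewrite [RHS]exchange_big; apply: eq_bigr => i _ /=.
  rewrite (exchange_big_dep xpredT)//=; apply: eq_bigr => r _.
  apply: eq_bigl => j; apply: andb_idl => eij; apply/existsP; by exists r.
(* Over ordered pairs, [M i] is counted twice the degree of [i]. *)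
have degM : \sum_i \sum_(j | U i j) (M i + M j) <= 2 * (eta * \sum_i M i).
  under eq_bigr do rewrite big_split/=.
  rewrite big_split/= [X in _ + X](edge_sum_swap (fun _ j => M j) U_sym)/= -mulr2n.
  rewrite -[X in X <= _]mulr_natl ler_pM2l// mulr_sumr; apply: ler_sum => i _.
  by rewrite sumr_const -mulr_natl ler_wpM2r//; have := eta_deg i; rewrite udegE.
have B0 : 0 < B%:R :> R by rewrite ltr0n.
set S := \sum_i \sum_(j | U i j) _.
set T := \sum_i \sum_(j | U i j) \sum_(r < B | _) _ in sumE.
have ST : S <= 3 * T + 3 * L ^+ 2 * B%:R * \sum_i \sum_(j | U i j) (M i + M j).
  rewrite /S /T !mulr_sumr -big_split; apply: ler_sum => i _ /=.
  rewrite !mulr_sumr -big_split; apply: ler_sum => j Uij /=.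
  by apply: le_trans (block_edge Uij) _; rewrite le_eqVlt; apply/orP; left; apply/eqP; ring.
have T_le : 2^-1 * T <= (V K - V (K + B)%N) / a by rewrite ler_pdivlMr// mulrC.
have M_le : \sum_i M i <= (V K - V (K + B)%N) / b by rewrite ler_pdivlMr// mulrC.
have c0 : 0 <= 3 * L ^+ 2 * B%:R.
  exact: mulr_ge0 (mulr_ge0 (ler0n _ 3) (sqr_ge0 L)) (ltW B0).
have h1 := ler_wpM2l c0 degM; have h2 := ler_wpM2l (mulr_ge0 c0 eta_ge0) M_le.
have -> : (3 * B%:R * L ^+ 2 * eta / b + 3 / a) * (V K - V (K + B)%N) =
  3 * L ^+ 2 * B%:R * eta * ((V K - V (K + B)%N) / b) +
  3 * ((V K - V (K + B)%N) / a) by field; rewrite !gt_eqF.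
lra.
Qed.

End BlockEstimate.

(** * The run of the algorithm *)

(* With [c > 0] this is the recursion [1 / a (t + 1) >= 1 / a t + lam / c] in
   division-free form. *)
Lemma sublinear_rate (R : realType) (a : nat -> R) (c lam : R) :
  0 < c -> 0 <= lam -> (forall t, 0 <= a t) ->
  (forall t, lam * a t ^+ 2 <= c * (a t - a t.+1)) ->
  forall t, a t * (c + lam * t%:R * a 0%N) <= c * a 0%N.
Proof.
move=> c0 l0 a0 rec; elim=> [|t IH]; first by rewrite mulr0 mul0r addr0 mulrC.
have dec : a t.+1 <= a t.
  rewrite -subr_ge0 -(pmulr_rge0 _ c0); apply: le_trans (rec t).
  by rewrite mulr_ge0 ?sqr_ge0.
have [at0|atn0] := eqVneq (a t) 0.
  have -> : a t.+1 = 0 by apply/eqP; rewrite eq_le a0 -at0 dec.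
  by rewrite mul0r; apply: mulr_ge0 (ltW c0) (a0 _).
have atp : 0 < a t by rewrite lt_def atn0 a0.
rewrite -(ler_pM2l atp).
have h1 : a t.+1 * (a t * (c + lam * t%:R * a 0%N)) <= a t.+1 * (c * a 0%N).
  by rewrite ler_wpM2l.
(* Monotonicity lets one factor [a t] of the recursion be replaced by [a t.+1]. *)
have h2 : a 0%N * (lam * a t * a t.+1) <= a 0%N * (c * (a t - a t.+1)).
  rewrite ler_wpM2l//; apply: le_trans (rec t).
  by rewrite expr2 -mulrA ler_wpM2l// ler_wpM2l.
rewrite -natr1; nra.
Qed.

Section Run.
Variables (R : realType) (n d : nat).
Variables (f : 'I_n -> 'rV[R]_d -> \bar R) (mu : R).
Variable g : 'I_n -> 'rV[R]_d -> 'rV[R]_d.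
Variables (E : nat -> rel 'I_n) (h : nat -> 'I_n -> 'I_n -> R).
Variables (beta c1 c2 : R) (m B : nat) (s1 : bool).
Variables (w : nat -> 'I_n -> 'rV[R]_d) (alpha : nat -> 'I_n -> 'I_n -> nat -> R).
Hypothesis mu0 : 0 < mu.
Hypothesis gP : forall i, cocoercive mu (conjf (f i)) (g i).
Hypothesis E_sym : forall k, symmetric (E k).
Hypothesis h_sym : forall k i j, E k i j -> h k i j = h k j i.
Hypothesis h_gt0 : forall k i j, E k i j -> 0 < h k i j.
Hypothesis h_low_gt0 : 0 < h_low E h.
Hypothesis h_sum : forall k i, \sum_(j | E k i j) h k i j <= 1.
Hypothesis betaP : 0 < beta < mu^-1^-1.
Hypotheses (c1_gt0 : 0 < c1) (c2_gt0 : 0 < c2).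
Hypothesis run : FDGM_AA_run s1 f g E h m mu^-1 beta c1 c2 w alpha.

Let L := mu^-1.
Let theta1 := Num.min (beta * (1 - beta * L)) c1.
Let theta2 := Num.min ((beta^-1 - L) / 2) c2.

Lemma theta1_gt0 : 0 < theta1.
Proof.
have /andP[b0 bL] := betaP.
rewrite /theta1 lt_min c1_gt0 andbT mulr_gt0// subr_gt0.
by rewrite -ltr_pdivlMr ?invr_gt0// mul1r.
Qed.

Lemma theta2_gt0 : 0 < theta2.
Proof.
have /andP[b0 bL] := betaP.
rewrite /theta2 lt_min c2_gt0 andbT divr_gt0// subr_gt0.
by rewrite -(invrK L) ltf_pV2// posrE ?invr_gt0// invr_gt0.
Qed.

Let half k i j :=
  half_step s1 f g E m L beta c1 c2 w k i j (alpha k i j) (alpha k j i).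

Lemma half_stepE k i j (a b : nat -> R) :
  half_step s1 f g E m L beta c1 c2 w k i j a b =
  if safeguard s1 (conjf (f i)) (conjf (f j)) (g i) (g j) L c1 c2
       (w k i) (w k j) (wbar E m g beta w k i j a b) (wbar E m g beta w k j i b a)
  then wbar E m g beta w k i j a b
  else w k i - beta *: (g i (w k i) - g j (w k j)).
Proof. by []. Qed.

Lemma IsetC k i j : Iset E m j i k = Iset E m i j k.
Proof. by rewrite /Iset; congr (take _ (rev _)); apply: eq_filter => t; rewrite E_sym. Qed.

Lemma half_step_pair k i j : E k i j ->
  let gap := conjf (f i) (half k i j) + conjf (f j) (half k j i) -
    conjf (f i) (w k i) - conjf (f j) (w k j) in
  let G := g i (w k i) - g j (w k j) in
  let du := half k i j - w k i in let dv := half k j i - w k j in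
  [/\ half k i j + half k j i = w k i + w k j,
      gap <= - (theta1 * dotv G G) &
      gap <= - (theta2 * (dotv du du + dotv dv dv))].
Proof.
move=> eij; have [_ [minE _]] := run.
have [[feas _] _] := minE _ _ _ eij.
rewrite /half !half_stepE [safeguard _ (conjf (f j)) _ _ _ _ _ _ _ _ _ _]safeguardC.
case: ifPn => [acc|_] /=.
  have [acc1 acc2] := safeguard_descent mu0 (gP i) (gP j) acc.
  split.
  - rewrite /wbar (IsetC k i j) -feas; apply/rowP => c; rewrite !mxE; ring.
  - apply: le_trans acc1 _; rewrite lerN2 ler_wpM2r ?dotv_ge0//.
    by rewrite /theta1 ge_min lexx orbT.
  - apply: le_trans acc2 _; rewrite lerN2 ler_wpM2r ?addr_ge0 ?dotv_ge0//.
    by rewrite /theta2 ge_min lexx orbT.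
have -> : w k j - beta *: (g j (w k j) - g i (w k i)) =
    w k j + beta *: (g i (w k i) - g j (w k j)).
  by rewrite -(opprB (g i _)) scalerN opprK.
have [] := gradient_exchange_descent c1 c2 mu0 (gP i) (gP j) betaP (w k i) (w k j).
by split=> //; rewrite addrACA addNr addr0.
Qed.

Let h_ge0 k i j : E k i j -> 0 <= h k i j.
Proof. by move=> /h_gt0/ltW. Qed.

Lemma run_stepE k : w k.+1 = fun i =>
  (1 - \sum_(j | E k i j) h k i j) *: w k i + \sum_(j | E k i j) h k i j *: half k i j.
Proof. by apply/funext => i; case: run => _ [_ ->]. Qed.

Lemma run_sum k : \sum_i w k i = 0.
Proof.
elim: k => [|k IH]; first by case: run.
rewrite run_stepE (avg_step_sum (E_sym k) (h_sym (k:=k)))// => i j eij.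
by have [] := half_step_pair eij.
Qed.

Lemma h_low_le k i j : E k i j -> h_low E h <= h k i j.
Proof.
move=> eij; apply: ge_inf; last by exists k, i, j.
by exists 0 => _ [l [i' [j' [e' ->]]]]; exact: h_ge0.
Qed.

Lemma run_edge_descent k : h_low E h * theta1 *
  (2^-1 * \sum_i \sum_(j | E k i j)
     dotv (g i (w k i) - g j (w k j)) (g i (w k i) - g j (w k j))) <=
  Dval f (w k) - Dval f (w k.+1).
Proof.
rewrite [w k.+1]run_stepE; apply: le_trans (avg_step_descent mu0 gP (E_sym k)
  (h_sym (k:=k)) (h_ge0 (k:=k)) (h_sum k)
  (q := fun i j => theta1 * dotv (g i (w k i) - g j (w k j)) (g i (w k i) - g j (w k j))) _).
  rewrite mulrCA ler_wpM2l// mulr_sumr; apply: ler_sum => i _.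
  rewrite mulr_sumr; apply: ler_sum => j eij.
  rewrite -mulrA ler_wpM2r ?h_low_le// mulr_ge0 ?dotv_ge0// ltW//.
  exact: theta1_gt0.
by move=> i j eij; have [] := half_step_pair eij.
Qed.

(** The choice of [q] holds the displacements of both ends, which offsets the factor 1/2. The
    weights stay inside the sum as in [avg_step_move], so [h_low] does not enter. *)
Lemma run_move_descent k :
  theta2 * dotS (fun i => w k.+1 i - w k i) (fun i => w k.+1 i - w k i) <=
  Dval f (w k) - Dval f (w k.+1).
Proof.
rewrite [w k.+1]run_stepE; apply: le_trans (avg_step_descent mu0 gP (E_sym k)
  (h_sym (k:=k)) (h_ge0 (k:=k)) (h_sum k) (q := fun i j => theta2 *
    (dotv (half k i j - w k i) (half k i j - w k i) +
     dotv (half k j i - w k j) (half k j i - w k j))) _); last first.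
  by move=> i j eij; have [] := half_step_pair eij.
apply: le_trans (ler_wpM2l (ltW theta2_gt0)
  (avg_step_move (h_ge0 (k:=k)) (h_sum k) (w k) (half k))) _.
set S := \sum_i _.
have SE : S = \sum_i \sum_(j | E k i j)
    h k i j * dotv (half k j i - w k j) (half k j i - w k j).
  rewrite /S edge_sum_swap//; apply: eq_bigr => i _; apply: eq_bigr => j eij.
  by rewrite (h_sym eij).
rewrite (_ : \sum_i _ = theta2 * (S + S)); last first.
  rewrite {2}SE /S -big_split mulr_sumr; apply: eq_bigr => i _ /=.
  rewrite -big_split mulr_sumr; apply: eq_bigr => j _ /=; ring.
by rewrite le_eqVlt; apply/orP; left; apply/eqP; field.
Qed.

Lemma run_noninc k l : (k <= l)%N -> Dval f (w l) <= Dval f (w k).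
Proof.
move=> kl; rewrite -(subnK kl); elim: (l - k)%N => // t; apply: le_trans.
rewrite -subr_ge0; apply: le_trans (run_move_descent _).
by rewrite mulr_ge0 ?dotS_ge0// ltW// theta2_gt0.
Qed.

Lemma run_in_S0 k : S0 f (w 0%N) (w k).
Proof. by split; [exact: run_noninc|exact: run_sum]. Qed.

Lemma maxdeg_le (e : rel 'I_n) i : (udeg e i <= maxdeg e <= n)%N.
Proof.
rewrite /maxdeg leq_bigmax/=; apply/bigmax_leqP => j _.
by rewrite -[X in (_ <= X)%N]card_ord max_card.
Qed.

Lemma eta_tilde_ge t i : (udeg (union_edges E B (t * B)) i)%:R <= eta_tilde E B :> R.
Proof.
have /andP[+ _] := maxdeg_le (union_edges E B (t * B)) i.
rewrite -(ler_nat R) => /le_trans; apply.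
apply: ub_le_sup; last by exists t.
exists n%:R => _ [s _ <-]; rewrite ler_nat.
by have /andP[] := maxdeg_le (union_edges E B (s * B)) i.
Qed.

Hypothesis E_irr : forall k, irreflexive (E k).
Hypothesis n_gt0 : (0 < n)%N.
Hypothesis B_gt0 : (0 < B)%N.
Hypothesis E_conn : forall k, graph_connected (union_edges E B k).

Lemma eta_tilde_ge0 : 0 <= eta_tilde E B :> R.
Proof. exact: le_trans (eta_tilde_ge 0 (Ordinal n_gt0)). Qed.

Lemma union_edges_sym k : symmetric (union_edges E B k).
Proof. by move=> i j; apply/existsP/existsP => -[r]; rewrite E_sym; exists r. Qed.

Lemma union_edges_irr k : irreflexive (union_edges E B k).
Proof. by move=> i; apply/existsP => -[r]; rewrite E_irr. Qed.

Lemma lambda_nz_ge0 k : 0 <= lambda_min_nz (@laplacian R n (union_edges E B k)).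
Proof.
by apply: lambda_min_nz_ge0; [exact: union_edges_sym|exact: union_edges_irr].
Qed.

Lemma lambda_low_ge0 : 0 <= lambda_low E B :> R.
Proof.
by apply: lb_le_inf; [exists (lambda_min_nz (laplacian (union_edges E B (0 * B)))), 0%N
  |move=> _ [t _ <-]; exact: lambda_nz_ge0].
Qed.

Lemma lambda_low_le t :
  lambda_low E B <= lambda_min_nz (@laplacian R n (union_edges E B (t * B))).
Proof.
apply: ge_inf; last by exists t.
by exists 0 => _ [s _ <-]; exact: lambda_nz_ge0.
Qed.

Let tau := 3 * B%:R * L ^+ 2 * eta_tilde E B / theta2 + 3 / (h_low E h * theta1).

Lemma tau_gt0 : 0 < tau.
Proof.
rewrite /tau ltr_wpDl//; last by rewrite divr_gt0// mulr_gt0// theta1_gt0.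
apply: divr_ge0 (ltW theta2_gt0); apply: mulr_ge0 eta_tilde_ge0.
by apply: mulr_ge0 (sqr_ge0 L); rewrite mulr_ge0.
Qed.

Lemma run_block_decrease t (X := fun i => g i (w (t * B) i)) :
  lambda_low E B * dotS (fun i => X i - mean X) (fun i => X i - mean X) <=
  tau * (Dval f (w (t * B)) - Dval f (w (t.+1 * B))).
Proof.
apply: le_trans (ler_wpM2r (dotS_ge0 _) (lambda_low_le t)) _.
apply: le_trans (spectral_gapS (@union_edges_sym _) (@union_edges_irr _)
  (E_conn _) X n_gt0) _.
rewrite mulSn addnC; apply: (@block_estimate _ _ _ g E w (fun k => Dval f (w k)) L
  (h_low E h * theta1) theta2 (eta_tilde E B) B (t * B)) => //.
- by move=> i x y; exact: (coco_lipschitz mu0 (gP i)).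
- by rewrite mulr_gt0// theta1_gt0.
- exact: theta2_gt0.
- exact: run_edge_descent.
- exact: run_move_descent.
- exact: eta_tilde_ge0.
- exact: eta_tilde_ge.
Qed.

(** Convexity bounds the gap by the pairing of [W - Ws] with the gradients; [W - Ws] sums to zero,
    so the mean gradient may be subtracted before Cauchy-Schwarz. *)
Lemma gap_le_consensus (W Ws : 'I_n -> 'rV[R]_d) (X := fun i => g i (W i)) :
  \sum_i W i = 0 -> \sum_i Ws i = 0 ->
  Dval f W - Dval f Ws <=
    normS (fun i => W i - Ws i) * normS (fun i => X i - mean X).
Proof.
move=> sW sWs; apply: le_trans (le_trans (ler_norm _) (cauchy_schwarzS _ _)).
have -> : dotS (fun i => W i - Ws i) (fun i => X i - mean X) =
    \sum_i dotv (W i - Ws i) (X i).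
  rewrite /dotS; under eq_bigr do rewrite dotvBr.
  by rewrite sumrB -(dotv_suml _ _ _ (mean X)) sumrB sW sWs subrr dot0v subr0.
rewrite /Dval -sumrB; apply: ler_sum => i _.
have := coco_convex mu0 (gP i) (W i) (Ws i).
by rewrite /X !dotvBl; lra.
Qed.

End Run.

Unset Implicit Arguments.

Theorem theorem1 (R : realType) (n d : nat) (hn : (1 <= n)%N) (hd : (1 <= d)%N)
  (f : 'I_n -> 'rV[R]_d -> \bar R) (mu : R) (hmu : 0 < mu)
  (hproper : forall i, proper_fun (f i))
  (hlsc : forall i, lower_semicontinuous (f i))
  (hsc : forall i, strongly_convex mu (f i))
  (hint : interior [set x | forall i, dom (f i) x] !=set0)
  (g : 'I_n -> 'rV[R]_d -> 'rV[R]_d)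
  (hg : forall i w x,
      ((dotv w x)%:E - f i x <= (dotv w (g i w))%:E - f i (g i w))%E)
  (E : nat -> rel 'I_n)
  (hEsym : forall k i j, E k i j = E k j i)
  (hEirr : forall k i, ~~ E k i i)
  (h : nat -> 'I_n -> 'I_n -> R)
  (hhsym : forall k i j, E k i j -> h k i j = h k j i)
  (hhpos : forall k i j, E k i j -> 0 < h k i j)
  (hhlow : 0 < h_low E h)
  (hhsum : forall k i, \sum_(j < n | E k i j) h k i j <= 1)
  (beta c1 c2 : R) (hbeta : 0 < beta < (mu^-1)^-1) (hc1 : 0 < c1) (hc2 : 0 < c2)
  (m : nat) (hm : (1 <= m)%N)
  (B : nat) (hB : (1 <= B)%N)
  (hconn : forall k, graph_connected (union_edges E B k))
  (s1 : bool) (w : nat -> 'I_n -> 'rV[R]_d)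
  (alpha : nat -> 'I_n -> 'I_n -> nat -> R)
  (hrun : FDGM_AA_run s1 f g E h m mu^-1 beta c1 c2 w alpha)
  (xstar : 'rV[R]_d)
  (hxstar : forall x, (Fval f (fun _ => xstar) <= Fval f (fun _ => x))%E) :
  let L := mu^-1 in
  let theta1 := Num.min (beta * (1 - beta * L)) c1 in
  let theta2 := Num.min ((beta^-1 - L) / 2) c2 in
  let tau := 3 * B%:R * L ^+ 2 * eta_tilde E B / theta2 + 3 / (h_low E h * theta1) in
  let Delta0 := Dval f (w 0%N) - Dstar f in
  let r0 := R0 f (w 0%N) in
  forall k : nat,
    let Deltak := Dval f (w k) - Dstar f in
    let xk := fun i => g i (w k i) in
    Deltak <= tau * r0 ^+ 2 * Delta0 /
              (tau * r0 ^+ 2 + lambda_low E B * (k %/ B)%:R * Delta0) /\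
    normS (fun i => xk i - xstar) <= Num.sqrt (2 * L * Deltak) /\
    (`| Fval f xk - Fstar f | <=
       ((r0 + normS (w 0%N)) * Num.sqrt (2 * L * Deltak))%:E)%E.
Proof.
move=> L theta1 theta2 tau Delta0 r0 k Deltak xk.
have gP i : cocoercive mu (conjf (f i)) (g i) by exact: conjf_cocoercive.
have Esym t : symmetric (E t) by move=> i j; exact: hEsym.
have Eirr t : irreflexive (E t) by move=> i; exact/negbTE.
have inS0 := run_in_S0 hmu gP Esym hhsym hhpos hhsum hbeta hc2 hrun.
have sum0 t : \sum_i w t i = 0 by have [] := inS0 t.
have [Ws [sWs DE Dmin gWs FE]] := strong_duality hmu hproper hsc hg hn hint hxstar.
split; last split.
- have SWs : S0 f (w 0%N) Ws by split=> //; rewrite -DE; exact: Dmin.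
  have r0_ge0 : 0 <= r0.
    apply: le_trans (R0_upper hmu hproper hsc hg hint (inS0 0%N) (inS0 0%N)).
    exact: normS_ge0.
  have lam0 := @lambda_low_ge0 R n E B Esym Eirr.
  have tau0 : 0 < tau by apply: tau_gt0.
  pose X t := fun i => g i (w (t * B)%N i).
  pose C t := normS (fun i => X t i - mean (X t)).
  pose a t := Dval f (w (t * B)%N) - Dstar f.
  have a0 t : 0 <= a t by rewrite subr_ge0 Dmin.
  have aC t : a t <= r0 * C t.
    rewrite /a DE; apply: le_trans (gap_le_consensus hmu gP (sum0 _) sWs) _.
    rewrite ler_wpM2r ?normS_ge0//.
    exact: (R0_upper hmu hproper hsc hg hint (inS0 (t * B)%N) SWs).
  (* The rate is proved at multiples of [B]; monotonicity covers the iterations in between. *)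
  have Dk : Deltak <= a (k %/ B)%N.
    rewrite lerD2r; apply: (run_noninc hmu gP Esym hhsym hhpos hhsum hbeta hc2 hrun).
    exact: leq_trunc_div.
  have a00 : a 0%N = Delta0 by rewrite /a mul0n.
  (* If the sublevel set has diameter zero, the claimed bound is 0 and so is the gap; otherwise the
     recursion constant [tau * r0 ^+ 2] is positive. *)
  have [rz|rn0] := eqVneq r0 0.
    rewrite rz expr0n/= mulr0 !mul0r.
    by apply: le_trans Dk _; apply: le_trans (aC _) _; rewrite rz mul0r.
  have c0 : 0 < tau * r0 ^+ 2 by rewrite mulr_gt0// exprn_gt0// lt_def rn0.
  apply: le_trans Dk _; rewrite -a00 ler_pdivlMr; last first.
    by rewrite ltr_wpDr// !mulr_ge0.
  apply: sublinear_rate => // t.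
  have dec : lambda_low E B * C t ^+ 2 <= tau * (a t - a t.+1).
    rewrite normS_sqr /a opprB addrA subrK; apply: run_block_decrease => //; exact: hrun.
  (* Squaring [a t <= r0 * C t] links the gap to the disagreement, which [dec] bounds by the
     decrease over the block. *)
  apply: (@le_trans _ _ (r0 ^+ 2 * (lambda_low E B * C t ^+ 2))).
    rewrite [leRHS]mulrCA ler_wpM2l// -exprMn ler_pXn2r ?nnegrE// mulr_ge0//.
    exact: normS_ge0.
  by rewrite (mulrC tau) -[leRHS]mulrA ler_wpM2l// sqr_ge0.
- exact: (primal_dist hmu hproper hsc hg hn hint hxstar (sum0 k)).
- exact: (primal_gap hmu hproper hsc hg hn hint hxstar (sum0 0%N) (inS0 k)).
Qed.
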